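(* Let $\mathbf Y_n=(\mathbf y_1,\dots,\mathbf y_n)=(y_{ij})_{n\times n}$ have i.i.d. $N(0,1)$ entries. Define by Gram–Schmidt $\mathbf w_1=\mathbf y_1$, $\boldsymbol\gamma_1=\mathbf w_1/\|\mathbf w_1\|$, and for $k=2,\dots,n$, $\mathbf w_k=\mathbf y_k-\sum_{i=1}^{k-1}\langle \mathbf y_k,\boldsymbol\gamma_i\rangle\boldsymbol\gamma_i$, $\boldsymbol\gamma_k=\mathbf w_k/\|\mathbf w_k\|$, and set $\boldsymbol\Gamma_n=(\boldsymbol\gamma_1,\dots,\boldsymbol\gamma_n)=(\gamma_{ij})$ (a Haar-distributed orthogonal matrix). For $1\le p,q\le n$ let $\boldsymbol\Gamma_{p\times q}=(\gamma_{ij})_{1\le i\le p,1\le j\le q}$, $\mathbf Y_{p\times q}=(y_{ij})_{1\le i\le p,1\le j\le q}$ and $\|\sqrt n\boldsymbol\Gamma_{p\times q}-\mathbf Y_{p\times q}\|_{\rm HS}^2=\sum_{i=1}^p\sum_{j=1}^q(\sqrt n\gamma_{ij}-y_{ij})^2$. Let $p=p_n$, $q=q_n$ with $1\le p,q\le n$. If $\lim_{n\to\infty}pq^2/n=0$, then $\|\sqrt n\boldsymbol\Gamma_{p\times q}-\mathbf Y_{p\times q}\|_{\rm HS}\to 0$ in probability as $n\to\infty$. If $\lim_{n\to\infty}pq^2/n=\sigma\in(0,\infty)$, then for every $\epsilon\in(0,\sqrt{\sigma/2})$, $$\liminf_{n\to\infty}P\big(\|\sqrt n\boldsymbol\Gamma_{p\times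 q}-\mathbf Y_{p\times q}\|_{\rm HS}\ge\epsilon\big)>0.$$ *)

(* Defs.v *)
From HB Require Import structures.
From mathcomp Require Import all_boot all_order all_algebra.
From mathcomp Require Import all_classical all_reals all_analysis.
Set Implicit Arguments. Unset Strict Implicit. Unset Printing Implicit Defensive.
Import Order.TTheory GRing.Theory Num.Theory.
Local Open Scope ring_scope.
Local Open Scope classical_set_scope.

Section GramSchmidt.
Variables (R : realType) (n : nat).

Definition dotv (u v : 'cV[R]_n) : R := \sum_(i < n) u i 0 * v i 0.
Definition normv (u : 'cV[R]_n) : R := Num.sqrt (dotv u u).

Definition gs_next (gs : seq 'cV[R]_n) (y : 'cV[R]_n) : seq 'cV[R]_n :=
  let w := y - \sum_(g <- gs) dotv y g *: g in
  rcons gs ((normv w)^-1 *: w).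

Definition gram_schmidt (ys : seq 'cV[R]_n) : seq 'cV[R]_n :=
  foldl gs_next [::] ys.

(* Gamma_n = (gamma_1, ..., gamma_n): j-th column is gamma_{j+1} *)
Definition GS_matrix (Y : 'M[R]_n) : 'M[R]_n :=
  \matrix_(i < n, j < n)
    (nth 0 (gram_schmidt [seq col j Y | j <- enum 'I_n]) j) i 0.

Definition HS_dist (p q : nat) (Y : 'M[R]_n) : R :=
  Num.sqrt (\sum_(i < n | (i < p)%N) \sum_(j < n | (j < q)%N)
              (Num.sqrt n%:R * GS_matrix Y i j - Y i j) ^+ 2).
End GramSchmidt.

Definition iid_std_normal_matrix d (T : measurableType d) (R : realType)
    (P : probability T R) (n : nat) (y : 'I_n -> 'I_n -> {RV P >-> R}) : Prop :=
  (forall i j (A : set R), measurable A ->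
     P (y i j @^-1` A) = normal_prob 0 1 A) /\
  (forall B : 'I_n -> 'I_n -> set R, (forall i j, measurable (B i j)) ->
     P [set t | forall i j, B i j (y i j t)] =
     (\prod_(i < n) \prod_(j < n) P (y i j @^-1` B i j))%E).

Definition Ymat d (T : measurableType d) (R : realType) (P : probability T R)
   (n : nat) (y : 'I_n -> 'I_n -> {RV P >-> R}) (t : T) : 'M[R]_n :=
  \matrix_(i < n, j < n) y i j t.

(* Main.v *)
(** Proof idea. Write [w_j] for the residual of the [j]-th column [y_j] (counted from 0),
    [s_j] for the squared norm of the projection of [y_j] on the previous [gamma_i], and
    [D_j = sqrt n - |w_j|].  Then [sqrt n gamma_j - y_j = D_j gamma_j - proj_j], so its
    squared norm is [D_j^2 |gamma_j|^2 + s_j].  Conditionally on the past, [<y_j, gamma_i>]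
    is standard normal, hence [E s_j] is about [j] and [E s_j^k = O(j^k)]; moreover
    [|w_j|^2 = |y_j|^2 - s_j], so that [E D_j^2] is at least about [1/2] and
    [E D_j^4 = O(1)] as long as [j^2 = O(n)].  The law of the matrix is invariant under row
    permutations, so the squared error [Z] on the [p x q] block has expectation
    [(p/n) sum_(j < q) E |sqrt n gamma_j - y_j|^2], which is [O(p q^2 / n)] and equivalent
    to [p q^2 / (2 n)] along sequences with [p q^2 / n -> sigma].  Markov's inequality gives
    the first claim.  For the second one, [E Z^2] is bounded (off-diagonal row products by
    exchangeability, diagonal ones by fourth moments of single entries), and
    [Z <= eps^2 + Z^2/(2L) + (L/2) 1_(Z >= eps^2)] bounds the probability from below.

    Degenerate residuals [w_j = 0] give [gamma_j = 0] since [0^-1 = 0]; they are not excluded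
    almost surely, but have probability at most [E D_j^4 / n^2]. *)

Require Import Defs.
From HB Require Import structures.
From mathcomp Require Import all_boot all_order all_algebra.
From mathcomp Require Import all_classical all_reals all_analysis.
From mathcomp Require Import fingroup perm measurable_realfun ring lra.
Import Order.TTheory GRing.Theory Num.Theory numFieldNormedType.Exports.
Set Implicit Arguments. Unset Strict Implicit. Unset Printing Implicit Defensive.
Local Open Scope ring_scope.
Local Open Scope classical_set_scope.

(** * Moments of the standard normal law *)

(** The constant 1/2 in the lower bound of [E D_j^2] has to be sharp: for bounded [q], the sum
    [q (q - 1) / 2] of the [j < q] falls short of [q^2 / 2] by a term of the same order, while the
    sum of the [1/2 + j] is exactly [q^2 / 2]. Hence a third-order expansion of the square root
    there, while crude constants do everywhere else. A mean close to [sigma / 2] would still allow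
    [Z] to be small with probability near 1; this is why [E Z^2] enters.

    Conditioning is never formalised: independence of a function from an entry means that the
    function ignores this entry, and resampling the entry preserves the law. Integrability is
    settled once and for all by a class of functions with all moments; the normalized vectors belong
    to it because their entries are bounded, without any estimate on [1 / |w_j|]. *)

Section NormalMoments.
Variable R : realType.
Local Notation mu := (@lebesgue_measure R).
Local Notation N := (normal_prob (0 : R) 1).
Local Notation phi := (normal_pdf (0 : R) 1).

Lemma normal_pdf_std x : phi x = normal_peak 1 * expR (- (x ^+ 2) / 2).
Proof.
rewrite normal_pdfE ?oner_eq0// /normal_fun subr0 expr1n; congr (_ * expR (_ / _)).
Qed.

(* exp(|x|) dominates all powers, and x^2/2 - |x| dominates x^2/8 up to a constant. *)
Lemma moment_pdf_bound k : exists2 K : R, 0 <= K &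
  forall x : R, `|x| ^+ k * phi x <= K * normal_pdf 0 2 x.
Proof.
have p2 : 0 < normal_peak 2 :> R by rewrite normal_peak_gt0.
exists (k`!%:R * expR 1 * normal_peak 1 / normal_peak 2).
  by rewrite !mulr_ge0 ?expR_ge0 ?normal_peak_ge0// invr_ge0 normal_peak_ge0.
move=> x; rewrite normal_pdf_std normal_pdfE//.
have xk : `|x| ^+ k <= k`!%:R * expR `|x|.
  case: k => [|k].
    by rewrite expr0 fact0 mul1r -expR0 ler_expR.
  rewrite -ler_pdivrMl ?ltr0n ?fact_gt0// mulrC.
  by apply: le_trans (expR_ge1Dxn k (normr_ge0 x)); rewrite lerDr.
have -> : k`!%:R * expR 1 * normal_peak 1 / normal_peak 2 *
   (normal_peak 2 * normal_fun 0 2 x) =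
   normal_peak 1 * (k`!%:R * (expR 1 * normal_fun 0 2 x)) :> R.
  by field; rewrite gt_eqF.
rewrite mulrCA ler_wpM2l ?normal_peak_ge0//.
apply: le_trans (ler_wpM2r (expR_ge0 _) xk) _.
rewrite -mulrA ler_wpM2l// /normal_fun -!expRD ler_expR subr0.
have -> : x ^+ 2 = `|x| ^+ 2 by rewrite real_normK ?num_real.
have -> : (2 : R) ^+ 2 *+ 2 = 8 by rewrite -mulr_natr; ring.
have := sqr_ge0 (`|x| - 2); nra.
Qed.

Lemma integrable_moment_pdf k : mu.-integrable setT (fun x => (x ^+ k * phi x)%:E).
Proof.
have [K K0 KP] := moment_pdf_bound k.
apply: (@le_integrable _ _ R mu setT measurableT _ (fun x => (K * normal_pdf 0 2 x)%:E)) => //.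
- apply/measurable_EFinP; apply: measurable_funM; last exact: measurable_normal_pdf.
  exact: measurable_funX.
- move=> x _ /=; rewrite lee_fin normrM normrX (ger0_norm (normal_pdf_ge0 _ _ _)).
  by rewrite [leRHS]ger0_norm// mulr_ge0// normal_pdf_ge0.
- under eq_fun do rewrite EFinM.
  by apply: integrableZl => //; exact: integrable_normal_pdf.
Qed.

(** The bound of order [k.+1] leaves a spare factor [1/n]. The sign [s] treats both ends of the line
    at once. *)
Lemma moment_pdf_cvg0 k (s : R) : `|s| = 1 ->
  (fun n : nat => (s * n%:R) ^+ k * phi (s * n%:R)) @ \oo --> (0 : R).
Proof.
move=> s1; have [K K0 KP] := moment_pdf_bound k.+1.
apply/norm_cvg0P.
apply: (@squeeze_cvgr _ _ _ _ (cst 0) (fun n => K * normal_peak 2 * n%:R^-1)).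
- near=> n.
  have n0 : 0 < n%:R :> R by rewrite ltr0n; near: n; exact: nbhs_infty_gt.
  rewrite normr_ge0/= ler_pdivlMr// normrM normrX normrM s1 mul1r.
  rewrite (ger0_norm (normal_pdf_ge0 _ _ _)) normr_nat mulrAC -exprSr.
  have := KP (s * n%:R); rewrite normrM s1 mul1r normr_nat => /le_trans; apply.
  by apply: ler_wpM2l => //; apply: normal_pdf_ub.
- exact: cvg_cst.
- rewrite -(mulr0 (K * normal_peak 2)).
  apply: cvgM; first exact: cvg_cst.
  apply/gtr0_cvgV0.
    near=> n; rewrite ltr0n; near: n; exact: nbhs_infty_gt.
  exact: cvgr_idn.
Unshelve. all: by end_near. Qed.

Lemma integral_symm_itv_cvg (h : R -> R) : mu.-integrable setT (EFin \o h) ->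
  (fun n : nat => (\int[mu]_(x in `[(- n%:R)%R, n%:R]) (h x)%:E)%E) @ \oo
    --> (\int[mu]_x (h x)%:E)%E.
Proof.
move=> ih; have mh := measurable_int _ ih.
under eq_fun do rewrite integral_mkcond.
apply: (@dominated_cvg _ _ _ mu setT measurableT _ _ (fun x => `|(h x)%:E|%E)) => //.
- by move=> n; apply: (iffLR (measurable_restrictT (EFin \o h) _)) => //; exact: measurable_funTS.
- move=> x _; apply: cvg_near_cst.
  near=> n; rewrite patchE mem_set//= in_itv/= -ler_norml.
  near: n; exact: nbhs_infty_ger.
- exact: integrable_abse.
- move=> n x _; rewrite patchE; case: ifP => // _.
  by rewrite abse0 abse_ge0.
Unshelve. all: by end_near. Qed.

(** The fundamental theorem of calculus on [[-n, n]], with dominated convergence for the integrals;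
    it replaces integration by parts. *)
Lemma integral_derivative_vanishing (F f : R -> R) :
  (forall x : R, is_derive x (1 : R) F (f x)) -> continuous f ->
  mu.-integrable setT (EFin \o f) ->
  (fun n : nat => F n%:R) @ \oo --> (0 : R) ->
  (fun n : nat => F (- n%:R)) @ \oo --> (0 : R) ->
  (\int[mu]_x (f x)%:E)%E = 0%E.
Proof.
move=> dF cf intf Fy FNy.
have Fc (x : R) : {for x, continuous F}.
  by apply: differentiable_continuous; apply/derivable1_diffP; case: (dF x).
rewrite -(cvg_lim _ (integral_symm_itv_cvg intf))//; apply/cvg_lim => //.
have -> : (0%E : \bar R) = (0 - 0 : R)%:E by rewrite subr0.
apply: (@cvg_trans _ ((F n%:R - F (- n%:R))%:E @[n --> \oo])).
  apply: near_eq_cvg; near=> n.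
  have n0 : (0 < n)%N by near: n; exact: nbhs_infty_gt.
  rewrite (@continuous_FTC2 _ f F) ?EFinB//.
  - by rewrite -subr_gt0 opprK -natrD ltr0n addn_gt0 n0.
  - by apply: continuous_subspaceT => x; exact: cf.
  - split.
    + by move=> x _; case: (dF x).
    + by apply: cvg_at_right_filter; exact: Fc.
    + by apply: cvg_at_left_filter; exact: Fc.
  - by move=> x _; rewrite derive1E; case: (dF x).
apply: cvg_EFin; first by near=> n.
exact: cvgB.
Unshelve. all: by end_near. Qed.

Lemma is_derive_normal_pdf_std (x : R) : is_derive x (1 : R) phi (- x * phi x).
Proof.
have -> : phi = (fun y => normal_peak 1 * expR (- (y ^+ 2) / 2)).
  by apply/funext => y; rewrite normal_pdf_std.
have d1 : is_derive x (1 : R) (fun y : R => - (y ^+ 2) / 2) (- x).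
  have := @is_deriveZ R R R (id ^+ 2) (- 2^-1) x 1 _ (is_deriveX 2 (@is_derive_id R R x 1)).
  rewrite [X in is_derive _ _ X _ -> _](_ : _ = (fun y : R => - (y ^+ 2) / 2)); last first.
    by apply/funext => y; rewrite !fctE/= /GRing.scale/=; ring.
  by move=> h; apply: is_derive_eq h _; rewrite /GRing.scale/=; field.
have := @is_deriveZ R R R _ (normal_peak 1) x 1 _
  (@is_derive1_comp R expR (fun y => - (y ^+ 2) / 2) x _ _ (is_derive_expR _) d1).
move=> h; apply: is_derive_eq h _; rewrite /GRing.scale/=; ring.
Qed.

(** The Radon-Nikodym derivative of [N] agrees with [phi] almost everywhere, both having the same
    integral over every measurable set. The nonnegative case, applied to [|f|], supplies the
    integrability that the signed case requires. *)
Lemma normal_prob_integral (f : R -> R) : measurable_fun setT f ->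
  mu.-integrable setT (fun x => (f x * phi x)%:E) ->
  N.-integrable setT (EFin \o f) /\
  (\int[N]_x (f x)%:E = \int[mu]_x (f x * phi x)%:E)%E.
Proof.
move=> mf intf.
have dom : N `<< mu := normal_prob_dominates 0 1.
have aephi : ae_eq mu setT (Radon_Nikodym_SigmaFinite.f N mu) (EFin \o phi).
  apply: integral_ae_eq => //.
  - exact: Radon_Nikodym_SigmaFinite.f_integrable.
  - by apply/measurable_EFinP; exact: measurable_normal_pdf.
  - by move=> A _ mA; rewrite -Radon_Nikodym_SigmaFinite.f_integral.
have ge0E (g : R -> R) : measurable_fun setT g -> (forall x, 0 <= g x) ->
    (\int[N]_x (g x)%:E = \int[mu]_x (g x * phi x)%:E)%E.
  move=> mg g0.
  rewrite -(Radon_Nikodym_SigmaFinite.change_of_variables dom)//; last exact/measurable_EFinP.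
  apply: ae_eq_integral => //.
  - apply: emeasurable_funM; first exact/measurable_EFinP.
    exact: measurable_int (Radon_Nikodym_SigmaFinite.f_integrable _).
  - apply/measurable_EFinP; apply: measurable_funM => //; exact: measurable_normal_pdf.
  - under [X in ae_eq _ _ _ X]eq_fun do rewrite EFinM.
    exact: ae_eqe_mul2l.
have intN : N.-integrable setT (EFin \o f).
  apply/integrableP; split; first exact/measurable_EFinP.
  rewrite [ltLHS](_ : _ = \int[N]_x (`|f x|)%:E)%E//.
  rewrite ge0E//; last exact: measurableT_comp.
  move/integrableP : intf => [_]; apply: le_lt_trans.
  apply: ge0_le_integral => //.
  - by move=> x _; rewrite lee_fin mulr_ge0// normal_pdf_ge0.
  - apply/measurable_EFinP; apply: measurable_funM; last exact: measurable_normal_pdf.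
    exact: measurableT_comp.
  - apply/measurable_EFinP; apply: measurableT_comp => //.
    by apply: measurable_funM => //; exact: measurable_normal_pdf.
  - by move=> x _ /=; rewrite lee_fin normrM (ger0_norm (normal_pdf_ge0 _ _ _)).
split=> //.
rewrite -(Radon_Nikodym_change_of_variables dom)//.
apply: ae_eq_integral => //.
- apply: emeasurable_funM; first exact/measurable_EFinP.
  by apply: (measurable_int mu); exact: Radon_Nikodym_integrable.
- by apply/measurable_EFinP; apply: measurable_funM => //; exact: measurable_normal_pdf.
- under [X in ae_eq _ _ _ X]eq_fun do rewrite EFinM.
  apply: ae_eqe_mul2l; apply: ae_eq_trans aephi.
  apply: ae_eq_sym; exact: ae_eq_Radon_Nikodym_SigmaFinite.
Qed.

Lemma integrable_moment k : N.-integrable setT (fun x : R => (x ^+ k)%:E).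
Proof.
by have [] := normal_prob_integral (measurable_funX k (@measurable_id _ R setT)) (integrable_moment_pdf k).
Qed.

Definition normal_moment k : R := fine (\int[N]_x (x ^+ k)%:E)%E.

Lemma normal_momentE k : normal_moment k = fine (\int[mu]_x (x ^+ k * phi x)%:E)%E.
Proof.
rewrite /normal_moment.
by have [_ ->] := normal_prob_integral (measurable_funX k (@measurable_id _ R setT)) (integrable_moment_pdf k).
Qed.

Lemma normal_moment0 : normal_moment 0 = 1.
Proof.
rewrite normal_momentE; under eq_integral do rewrite expr0 mul1r.
by rewrite integral_normal_pdf.
Qed.

(** Stein's identity: [k x^(k-1) phi - x^(k+1) phi] is the derivative of [x^k phi]. At [k = 0] the
    truncated [k.-1] is harmless, its factor being 0. *)
Lemma normal_moment_rec k : normal_moment k.+1 = k%:R * normal_moment k.-1.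
Proof.
rewrite !normal_momentE.
have : (\int[mu]_x ((k%:R * (x ^+ k.-1 * phi x))%:E - (x ^+ k.+1 * phi x)%:E) = 0)%E.
  apply: (@integral_derivative_vanishing (fun x => x ^+ k * phi x)
    (fun x => k%:R * (x ^+ k.-1 * phi x) - x ^+ k.+1 * phi x)).
  - move=> x; have := is_deriveM (is_deriveX k (@is_derive_id R R x 1)) (is_derive_normal_pdf_std x).
    have -> : (id ^+ k : R -> R) * phi = (fun x => x ^+ k * phi x).
      by apply/funext => y; rewrite !fctE.
    by move=> h; apply: is_derive_eq h _; rewrite !fctE /GRing.scale/= exprSr; ring.
  - move=> x; apply: cvgB.
      apply: cvgM; first exact: cvg_cst.
      by apply: cvgM; [exact: exprn_continuous|exact: continuous_normal_pdf].
    by apply: cvgM; [exact: exprn_continuous|exact: continuous_normal_pdf].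
  - rewrite (_ : EFin \o _ = (fun x => ((k%:R * (x ^+ k.-1 * phi x))%:E
        - (x ^+ k.+1 * phi x)%:E)%E))//.
    apply: integrableB => //.
      under eq_fun do rewrite EFinM.
      apply: integrableZl => //; exact: integrable_moment_pdf.
    exact: integrable_moment_pdf.
  - have := @moment_pdf_cvg0 k 1 (normr1 _).
    by under eq_cvg do rewrite mul1r.
  - have := @moment_pdf_cvg0 k (-1) (normrN1 _).
    by under eq_cvg do rewrite mulN1r.
rewrite integralB//; last 2 first.
- under eq_fun do rewrite EFinM.
  apply: integrableZl => //; exact: integrable_moment_pdf.
- exact: integrable_moment_pdf.
under eq_integral do rewrite EFinM.
rewrite integralZl//; last exact: integrable_moment_pdf.
rewrite -[X in (_ * X - _)%E]fineK; last first.
  by apply: integrable_fin_num => //; exact: integrable_moment_pdf.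
rewrite -[X in (_ - X)%E]fineK; last first.
  by apply: integrable_fin_num => //; exact: integrable_moment_pdf.
by move/eqP; rewrite -EFinM -EFinB eqe subr_eq0 => /eqP <-.
Qed.

Lemma normal_moment1 : normal_moment 1 = 0.
Proof. by rewrite normal_moment_rec mul0r. Qed.
End NormalMoments.

(** * Random variables with all moments *)

Section Expectation.
Context d (T : measurableType d) (R : realType) (P : probability T R).

Definition Ex (f : T -> R) : R := fine (\int[P]_x (f x)%:E)%E.

(* A class closed under sums and products, on which [Ex] is linear. *)
Definition tame (f : T -> R) : Prop := measurable_fun setT f /\
  forall k, P.-integrable setT (fun x => (`|f x| ^+ k)%:E).

Lemma tame_measurable f : tame f -> measurable_fun setT f.
Proof. by case. Qed.

Lemma tame_integrable f : tame f -> P.-integrable setT (fun x => (f x)%:E).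
Proof.
move=> [mf /(_ 1%N)]; apply: le_integrable => //; first exact/measurable_EFinP.
by move=> x _ /=; rewrite lee_fin expr1 normr_id.
Qed.

Lemma tame_le (f g : T -> R) : measurable_fun setT g -> tame f ->
  (forall x, `|g x| <= `|f x|) -> tame g.
Proof.
move=> mg [mf fk] gf; split=> // k; move: (fk k); apply: le_integrable => //.
  by apply/measurable_EFinP; apply: measurable_funX; exact: measurableT_comp.
by move=> x _ /=; rewrite lee_fin !normrX !normr_id lerXn2r ?nnegrE.
Qed.

Lemma tame_cst c : tame (fun=> c).
Proof.
split=> // k; by apply: finite_measure_integrable_cst => //; exact: measurableT.
Qed.

Lemma tame_normr f : tame f -> tame (fun x => `|f x|).
Proof.
move=> tf; apply: (tame_le _ tf) => [|x]; last by rewrite normr_id.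
by apply: measurableT_comp => //; case: tf.
Qed.

Lemma tameD f g : tame f -> tame g -> tame (fun x => f x + g x).
Proof.
move=> [mf fk] [mg gk]; split; first exact: measurable_funD.
move=> k.
have : P.-integrable setT (fun x => ((2 ^+ k)%:E * ((`|f x| ^+ k)%:E + (`|g x| ^+ k)%:E))%E).
  by apply: integrableZl => //; exact: integrableD.
apply: le_integrable => //.
  apply/measurable_EFinP; apply: measurable_funX; apply: measurableT_comp => //.
  exact: measurable_funD.
move=> x _ /=; rewrite lee_fin ger0_norm ?exprn_ge0//.
rewrite [leRHS]ger0_norm; last by rewrite mulr_ge0 ?addr_ge0 ?exprn_ge0.
have H a b : 0 <= a -> a <= b -> (a + b) ^+ k <= 2 ^+ k * (a ^+ k + b ^+ k) :> R.
  move=> a0 ab; apply: (@le_trans _ _ ((2 * b) ^+ k)).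
    by rewrite lerXn2r ?nnegrE; lra.
  by rewrite exprMn ler_wpM2l ?exprn_ge0// lerDr exprn_ge0.
apply: (@le_trans _ _ ((`|f x| + `|g x|) ^+ k)).
  by rewrite lerXn2r ?nnegrE ?addr_ge0// ler_normD.
case: (leP `|f x| `|g x|) => [|/ltW] h; first exact: H.
have := H _ _ (normr_ge0 (g x)) h.
by rewrite [`|g x| + _]addrC [_ ^+ k + _]addrC.
Qed.

Lemma tameM f g : tame f -> tame g -> tame (fun x => f x * g x).
Proof.
move=> [mf fk] [mg gk]; split; first exact: measurable_funM.
move=> k.
have : P.-integrable setT (fun x => ((`|f x| ^+ (k * 2))%:E + (`|g x| ^+ (k * 2))%:E)%E).
  exact: integrableD.
apply: le_integrable => //.
  apply/measurable_EFinP; apply: measurable_funX; apply: measurableT_comp => //.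
  exact: measurable_funM.
move=> x _ /=; rewrite lee_fin ger0_norm ?exprn_ge0//.
rewrite [leRHS]ger0_norm; last by rewrite ?addr_ge0 ?exprn_ge0.
rewrite normrM exprMn !exprM.
set a := _ ^+ k; set b := _ ^+ k.
by have := sqr_ge0 (a - b); have := sqr_ge0 a; have := sqr_ge0 b; nra.
Qed.

Lemma tameX f m : tame f -> tame (fun x => f x ^+ m).
Proof.
move=> tf; elim: m => [|m IH]; first exact: tame_cst.
by under eq_fun do rewrite exprS; exact: tameM.
Qed.

Lemma tameZ c f : tame f -> tame (fun x => c * f x).
Proof. by move=> tf; apply: tameM => //; exact: tame_cst. Qed.

Lemma tameN f : tame f -> tame (fun x => - f x).
Proof. by move=> /(tameZ (-1)); under eq_fun do rewrite mulN1r. Qed.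

Lemma tameB f g : tame f -> tame g -> tame (fun x => f x - g x).
Proof. by move=> tf tg; apply: tameD => //; exact: tameN. Qed.

Lemma tame_sum I (r : seq I) (Q : pred I) (F : I -> T -> R) :
  (forall i, Q i -> tame (F i)) -> tame (fun x => \sum_(i <- r | Q i) F i x).
Proof.
move=> tF; elim: r => [|i r IH].
  by under eq_fun do rewrite big_nil; exact: tame_cst.
under eq_fun do rewrite big_cons.
by case: (boolP (Q i)) => [Qi|_] //; apply: tameD => //; exact: tF.
Qed.

Lemma eq_Ex f g : f =1 g -> Ex f = Ex g.
Proof. by move=> /funext ->. Qed.

Lemma Ex_cst c : Ex (fun=> c) = c.
Proof. by have := @Rintegral_cst _ _ _ P setT measurableT c; rewrite [X in fine X](@probability_setT _ _ _ P) mulr1. Qed.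

Lemma ExD f g : tame f -> tame g -> Ex (fun x => f x + g x) = Ex f + Ex g.
Proof.
move=> /tame_integrable tf /tame_integrable tg; rewrite /Ex.
by under eq_integral do rewrite EFinD; rewrite integralD//= fineD//; exact: integrable_fin_num.
Qed.

Lemma ExZ c f : tame f -> Ex (fun x => c * f x) = c * Ex f.
Proof.
move=> /tame_integrable tf; rewrite /Ex.
under eq_integral do rewrite EFinM.
by rewrite integralZl//= fineM//; exact: integrable_fin_num.
Qed.

Lemma ExN f : tame f -> Ex (fun x => - f x) = - Ex f.
Proof. by move=> tf; under eq_fun do rewrite -mulN1r; rewrite ExZ// mulN1r. Qed.

Lemma ExB f g : tame f -> tame g -> Ex (fun x => f x - g x) = Ex f - Ex g.
Proof. by move=> tf tg; rewrite ExD ?ExN//; exact: tameN. Qed.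

Lemma Ex_sum I (r : seq I) (Q : pred I) (F : I -> T -> R) :
  (forall i, Q i -> tame (F i)) ->
  Ex (fun x => \sum_(i <- r | Q i) F i x) = \sum_(i <- r | Q i) Ex (F i).
Proof.
move=> tF; elim: r => [|i r IH].
  by under eq_fun do rewrite big_nil; rewrite Ex_cst big_nil.
under eq_fun do rewrite big_cons; rewrite big_cons.
case: (boolP (Q i)) => [Qi|_] //; rewrite ExD ?IH//; first exact: tF.
exact: tame_sum.
Qed.

Lemma Ex_ge0 f : (forall x, 0 <= f x) -> 0 <= Ex f.
Proof. by move=> f0; apply: fine_ge0; apply: integral_ge0 => x _; rewrite lee_fin. Qed.

Lemma le_Ex f g : tame f -> tame g -> (forall x, f x <= g x) -> Ex f <= Ex g.
Proof.
move=> tf tg fg; rewrite -subr_ge0 -ExB//; apply: Ex_ge0 => x.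
by rewrite subr_ge0.
Qed.

Lemma tame_indic (A : set T) : measurable A -> tame (\1_A : T -> R).
Proof.
move=> mA; apply: (tame_le _ (tame_cst 1)); first exact: measurable_indic.
by move=> x; rewrite indicE normr1 normr_nat; case: (_ \in _).
Qed.

Lemma Ex_indic (A : set T) : measurable A -> Ex (\1_A : T -> R) = fine (P A).
Proof. by move=> mA; rewrite /Ex integral_indic// setIT. Qed.

End Expectation.

(** * Expectations under measure-preserving maps and on products *)

Section Transfer.
Context d1 d2 (T1 : measurableType d1) (T2 : measurableType d2) (R : realType).
Variables (P1 : probability T1 R) (P2 : probability T2 R) (phi : T1 -> T2).
Hypothesis mphi : measurable_fun setT phi.
Hypothesis P12 : forall A, measurable A -> P1 (phi @^-1` A) = P2 A.

Let mphi_mixin := isMeasurableFun.Build _ _ _ _ _ mphi.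
Let phi_ : {mfun T1 >-> T2} := HB.pack phi mphi_mixin.

(** The nonnegative case comes first: it shows that [f \o phi] has all moments, which the signed
    change of variables in [Ex_transfer] presupposes. *)
Lemma ge0_integral_transfer (f : T2 -> \bar R) : measurable_fun setT f ->
  (forall y, 0 <= f y)%E -> (\int[P1]_x f (phi x) = \int[P2]_y f y)%E.
Proof.
move=> mf f0; rewrite (eq_measure_integral (distribution P1 phi_)); last first.
  by move=> A mA _; exact/esym/P12.
by rewrite ge0_integral_distribution.
Qed.

Lemma tame_transfer (f : T2 -> R) : tame P2 f -> tame P1 (fun x => f (phi x)).
Proof.
move=> [mf fk]; split; first exact: measurableT_comp.
move=> k; apply/integrableP; split.
  apply/measurable_EFinP; apply: measurable_funX; apply: measurableT_comp => //.
  exact: measurableT_comp.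
have /integrableP[m] := fk k; apply: le_lt_trans.
by rewrite (ge0_integral_transfer (f := fun y => `|(`|f y| ^+ k)%:E|%E)) => //; exact: measurableT_comp.
Qed.

Lemma Ex_transfer (f : T2 -> R) : tame P2 f -> Ex P1 (fun x => f (phi x)) = Ex P2 f.
Proof.
move=> tf; rewrite /Ex; congr fine.
rewrite [RHS](eq_measure_integral (distribution P1 phi_)); last first.
  by move=> A mA _; exact/esym/P12.
rewrite integral_distribution//; last exact: (tame_integrable (tame_transfer tf)).
by apply/measurable_EFinP; case: tf.
Qed.

End Transfer.

Section ProductExpectation.
Context d1 d2 (T1 : measurableType d1) (T2 : measurableType d2) (R : realType).
Variables (P1 : probability T1 R) (P2 : probability T2 R).

Lemma Ex_prod_mul (f : T1 -> R) (g : T2 -> R) : tame P1 f -> tame P2 g ->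
  Ex (P1 \x P2)%E (fun p => f p.1 * g p.2) = Ex P1 f * Ex P2 g.
Proof.
move=> tf tg; have if_ := tame_integrable tf; have ig := tame_integrable tg.
have mfg : measurable_fun setT (fun p : T1 * T2 => (f p.1 * g p.2)%:E).
  apply/measurable_EFinP; apply: measurable_funM.
    by apply: (measurableT_comp (f := f)) => //; exact: tame_measurable tf.
  by apply: (measurableT_comp (f := g)) => //; exact: tame_measurable tg.
rewrite /Ex -(integral12_prod_meas1 (f := fun p : T1 * T2 => (f p.1 * g p.2)%:E)); last first.
  apply/integrable12ltyP => //=.
  under eq_integral => x _.
    under eq_integral do rewrite normrM EFinM.
    rewrite integralZl//; last exact: (integrable_abse ig).
    rewrite muleC -[X in (X * _)%E]fineK; last first.
      by apply: integrable_fin_num => //; exact: (integrable_abse ig).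
    over.
  rewrite integralZl//; last exact: (integrable_abse if_).
  rewrite -[X in (_ * X)%E]fineK; last first.
    by apply: integrable_fin_num => //; exact: (integrable_abse if_).
  by rewrite -EFinM ltry.
under eq_integral => x _.
  rewrite /fubini_F; under eq_integral do rewrite /= EFinM.
  rewrite integralZl// muleC -[X in (X * _)%E]fineK; last exact: integrable_fin_num.
  over.
rewrite integralZl// -[X in (_ * X)%E]fineK; last exact: integrable_fin_num.
by rewrite -EFinM/= mulrC.
Qed.

End ProductExpectation.

(** * The law of a matrix with independent standard normal entries *)

Section MatrixLaw.
Variables (R : realType) (n : nat).

Definition mx_box (B : 'I_n -> 'I_n -> set R) : set 'M[R]_n :=
  [set M | forall i j, B i j (M i j)].

Definition mx_boxes : set (set 'M[R]_n) :=
  [set C | exists2 B, (forall i j, measurable (B i j)) & C = mx_box B].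

(** The sigma-algebra is generated by the boxes because independence is a statement about their
    probabilities; as they are closed under intersection, a probability is determined by its values
    on them. *)
Definition mxT := g_sigma_algebraType mx_boxes.

Lemma setI_closed_mx_boxes : setI_closed mx_boxes.
Proof.
move=> _ _ [B mB ->] [C mC ->]; exists (fun i j => B i j `&` C i j).
  by move=> i j; apply: measurableI.
rewrite eqEsubset; split => [M [h1 h2] i j|M h]; first by split; [exact: h1|exact: h2].
by split => i j; case: (h i j).
Qed.

Lemma mx_boxes_setT : mx_boxes setT.
Proof. by exists (fun _ _ => setT) => //; rewrite eqEsubset; split. Qed.

Lemma measurable_mx_box B : (forall i j, measurable (B i j)) ->
  measurable (mx_box B : set mxT).
Proof. by move=> mB; apply: sub_sigma_algebra; exists B. Qed.

Lemma measure_mx_unique (m1 m2 : {measure set mxT -> \bar R}) :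
  (forall B, (forall i j, measurable (B i j)) -> m1 (mx_box B) = m2 (mx_box B)) ->
  (m1 setT < +oo)%E -> forall A : set mxT, measurable A -> m1 A = m2 A.
Proof.
move=> m12 m1y A mA.
apply: (@measure_unique _ R mxT mx_boxes (fun _ => setT)) => //.
- exact: setI_closed_mx_boxes.
- by move=> _; exact: mx_boxes_setT.
- by rewrite bigcup_const//; exists 0%N.
- by move=> _ [B mB ->]; exact: m12.
Qed.

Lemma measurable_entry i j : measurable_fun setT (fun M : mxT => M i j).
Proof.
move=> _ B mB; rewrite setTI.
rewrite [X in measurable X](_ : _ = mx_box (fun i' j' =>
  if (i' == i) && (j' == j) then B else setT)).
  by apply: measurable_mx_box => i' j'; case: ifP.
rewrite eqEsubset; split => M /=.
  by move=> BM i' j'; case: ifP => // /andP[/eqP -> /eqP ->].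
by move=> /(_ i j); rewrite !eqxx.
Qed.

Lemma measurable_fun_mx d (T : measurableType d) (f : T -> mxT) :
  (forall i j, measurable_fun setT (fun t => f t i j)) -> measurable_fun setT f.
Proof.
move=> mf; apply: (@measurability _ _ _ _ setT f mx_boxes) => //.
move=> _ [_ [B mB ->] <-]; rewrite setTI.
rewrite [X in measurable X](_ : _ =
  \bigcap_(i in [set: 'I_n]) \bigcap_(j in [set: 'I_n]) ((fun t => f t i j) @^-1` B i j)).
  apply: fin_bigcap_measurable => // i _; apply: fin_bigcap_measurable => // j _.
  by rewrite -[X in measurable X]setTI; exact: mf.
by rewrite eqEsubset; split => [t h i _ j _|t h i j]; apply: h.
Qed.

Definition mx_upd (a b : 'I_n) (p : measurableTypeR R * mxT) : mxT :=
  \matrix_(i, j) if (i == a) && (j == b) then p.1 else (p.2 : 'M[R]_n) i j.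

Lemma measurable_mx_upd a b : measurable_fun setT (mx_upd a b).
Proof.
apply: measurable_fun_mx => i j; case: (boolP ((i == a) && (j == b))) => [e|e].
  by under eq_fun do rewrite mxE e; exact: measurable_fst.
under eq_fun do rewrite mxE (negbTE e).
apply: (@measurableT_comp _ _ _ _ _ _ (fun M : mxT => M i j) _ snd) => //.
exact: measurable_entry.
Qed.

Definition mx_rperm (s : {perm 'I_n}) (M : mxT) : mxT := row_perm s M.

Lemma measurable_mx_rperm s : measurable_fun setT (mx_rperm s).
Proof.
apply: measurable_fun_mx => i j.
by under eq_fun do rewrite mxE; exact: measurable_entry.
Qed.

Definition std_normal_mx (nu : set mxT -> \bar R) :=
  forall B, (forall i j, measurable (B i j)) ->
  nu (mx_box B) = (\prod_(i < n) \prod_(j < n) normal_prob 0 1 (B i j))%E.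

Section Law.
Variable nu : probability mxT R.
Hypothesis nuN : std_normal_mx nu.
Local Notation N := (normal_prob (0 : R) 1).

Lemma std_normal_mx_unique d (T : measurableType d) (P : probability T R)
    (phi : T -> mxT) (mphi : measurable_fun setT phi) :
  (forall B, (forall i j, measurable (B i j)) ->
    P (phi @^-1` mx_box B) = (\prod_(i < n) \prod_(j < n) N (B i j))%E) ->
  forall A : set mxT, measurable A -> P (phi @^-1` A) = nu A.
Proof.
move=> h A mA.
pose phi_ : {mfun T >-> mxT} := HB.pack phi (isMeasurableFun.Build _ _ _ _ _ mphi).
apply: (@measure_mx_unique (distribution P phi_) nu) => //.
  by move=> B mB; apply: etrans (h B mB) _; exact/esym/nuN.
by rewrite [X in (X < _)%E](@probability_setT _ _ _ (distribution P phi_)) ltry.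
Qed.

(* Resampling one entry leaves the law unchanged; with Fubini this replaces every use of
   the independence of an entry from the others. *)
Lemma std_normal_mx_upd a b (A : set mxT) : measurable A ->
  (N \x nu)%E (mx_upd a b @^-1` A) = nu A.
Proof.
apply: std_normal_mx_unique; first exact: measurable_mx_upd.
move=> B mB.
rewrite (_ : _ @^-1` _ = B a b `*`
   mx_box (fun i j => if (i == a) && (j == b) then setT else B i j)); last first.
  rewrite eqEsubset; split=> -[x M] /=.
    move=> h; split; first by have := h a b; rewrite mxE !eqxx.
    by move=> i j; have := h i j; rewrite mxE/=; case: ifP.
  case=> Bx h i j; rewrite mxE/=; have := h i j.
  by case: ifP => // /andP[/eqP -> /eqP ->].
transitivity (N (B a b) * nu (mx_box (fun i j =>
    if (i == a) && (j == b) then setT else B i j)))%E.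
  apply: product_measure1E; first exact: mB.
  by apply: measurable_mx_box => i j; case: ifP.
rewrite nuN; last by move=> i j; case: ifP.
rewrite (bigD1 a)//= [X in _ = X](bigD1 a)//= (bigD1 b)//= [in RHS](bigD1 b)//=.
rewrite !eqxx/= probability_setT mul1e -!muleA; congr (_ * _)%E.
rewrite -!/(mule _ _).
congr (_ * _)%E.
  by apply: eq_bigr => j /negbTE ->.
by apply: eq_bigr => i /negbTE ->; apply: eq_bigr => j _.
Qed.

Lemma std_normal_mx_rperm s (A : set mxT) : measurable A ->
  nu (mx_rperm s @^-1` A) = nu A.
Proof.
apply: std_normal_mx_unique; first exact: measurable_mx_rperm.
move=> B mB.
rewrite (_ : _ @^-1` _ = mx_box (fun i => B ((s^-1)%g i))).
  rewrite nuN//.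
  rewrite [RHS](reindex_inj (@perm_inj _ (s^-1)%g))/=.
  by [].
rewrite eqEsubset; split=> M /= h i j.
  by have := h ((s^-1)%g i) j; rewrite mxE permKV.
by have := h (s i) j; rewrite permK mxE.
Qed.

Local Notation E := (Ex nu).

Lemma std_normal_mx_entry i j (A : set R) : measurable A ->
  nu ((fun M : mxT => M i j) @^-1` A) = N A.
Proof.
move=> mA; rewrite (_ : _ @^-1` _ = mx_box (fun i' j' =>
  if (i' == i) && (j' == j) then A else setT)); last first.
  rewrite eqEsubset; split => M /=.
    by move=> BM i' j'; case: ifP => // /andP[/eqP -> /eqP ->].
  by move=> /(_ i j); rewrite !eqxx.
rewrite nuN; last by move=> i' j'; case: ifP.
rewrite (bigD1 i)//= (bigD1 j)//= !eqxx/= big1 ?mule1; last first.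
  by move=> j' /negbTE ->; rewrite [LHS](@probability_setT _ _ _ N).
rewrite big1 ?mule1// => i' /negbTE ->; rewrite big1// => j' _.
by rewrite [LHS](@probability_setT _ _ _ N).
Qed.

Lemma tame_normal_id : tame N (fun x : R => x).
Proof.
split=> // k; have := integrable_abse (integrable_moment R k).
by apply: eq_integrable => // x _ /=; rewrite normrX.
Qed.

Lemma tame_entry i j : tame nu (fun M : mxT => M i j).
Proof.
have m : measurable_fun setT ((fun M => M i j) : mxT -> measurableTypeR R).
  exact: measurable_entry.
exact: (@tame_transfer _ _ _ _ _ _ _ _ m (@std_normal_mx_entry i j) _ tame_normal_id).
Qed.

Lemma Ex_rperm s (f : mxT -> R) : tame nu f -> E (fun M => f (mx_rperm s M)) = E f.
Proof.
move=> tf; apply: Ex_transfer => //; first exact: measurable_mx_rperm.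
exact: std_normal_mx_rperm.
Qed.

(** The second hypothesis says pathwise that [f] ignores the entry [(a, b)]; after this entry is
    resampled from [N], the integrand is a product on a product space. *)
Lemma Ex_mul_entry (f : mxT -> R) a b k : tame nu f ->
  (forall M x, f (mx_upd a b (x, M)) = f M) ->
  E (fun M => f M * M a b ^+ k) = normal_moment R k * E f.
Proof.
move=> tf fupd.
rewrite -(Ex_transfer (P1 := (N \x nu)%E) (measurable_mx_upd a b)); last 2 first.
- exact: std_normal_mx_upd.
- by apply: tameM => //; apply: tameX; exact: tame_entry.
rewrite -(Ex_prod_mul (P1 := N) (f := fun x => x ^+ k))//; last first.
  by apply: tameX; exact: tame_normal_id.
apply: eq_Ex => -[x M]; rewrite fupd/= mxE !eqxx/= mulrC//.
Qed.
End Law.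
End MatrixLaw.

(** * Gram-Schmidt orthogonalisation *)

Section DotProduct.
Variables (R : realType) (n : nat).
Implicit Types u v w : 'cV[R]_n.

Lemma dotvC u v : dotv u v = dotv v u.
Proof. by apply: eq_bigr => i _; rewrite mulrC. Qed.

Lemma dotvDl u v w : dotv (u + v) w = dotv u w + dotv v w.
Proof. by rewrite /dotv -big_split; apply: eq_bigr => i _; rewrite mxE mulrDl. Qed.

Lemma dotvZl c u v : dotv (c *: u) v = c * dotv u v.
Proof. by rewrite /dotv mulr_sumr; apply: eq_bigr => i _; rewrite mxE mulrA. Qed.

Lemma dotv0l v : dotv 0 v = 0.
Proof. by rewrite /dotv big1// => i _; rewrite mxE mul0r. Qed.

Lemma dotvNl u v : dotv (- u) v = - dotv u v.
Proof. by rewrite -scaleN1r dotvZl mulN1r. Qed.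

Lemma dotvBl u v w : dotv (u - v) w = dotv u w - dotv v w.
Proof. by rewrite dotvDl dotvNl. Qed.

Lemma dotvBr u v w : dotv w (u - v) = dotv w u - dotv w v.
Proof. by rewrite dotvC dotvBl !(dotvC w). Qed.

Lemma dotvZr c u v : dotv v (c *: u) = c * dotv v u.
Proof. by rewrite dotvC dotvZl (dotvC v). Qed.

Lemma dotv_suml I (r : seq I) (Q : pred I) (F : I -> 'cV[R]_n) v :
  dotv (\sum_(i <- r | Q i) F i) v = \sum_(i <- r | Q i) dotv (F i) v.
Proof.
elim/big_rec2: _ => [|i x y _ <-]; first by rewrite dotv0l.
by rewrite dotvDl.
Qed.

Lemma dotvv_ge0 u : 0 <= dotv u u.
Proof. by apply: sumr_ge0 => i _; rewrite -expr2 sqr_ge0. Qed.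

Lemma dotvv_eq0 u : dotv u u = 0 -> u = 0.
Proof.
move=> /eqP; rewrite psumr_eq0; last by move=> i _; rewrite -expr2 sqr_ge0.
move=> /allP h; apply/matrixP => i j; rewrite mxE (ord1 j).
have := h i (mem_index_enum i); by rewrite -expr2 sqrf_eq0 => /eqP.
Qed.

Lemma normv_ge0 u : 0 <= normv u.
Proof. exact: sqrtr_ge0. Qed.

Lemma sqr_normv u : normv u ^+ 2 = dotv u u.
Proof. by rewrite sqr_sqrtr// dotvv_ge0. Qed.

Lemma normv_eq0 u : normv u = 0 -> u = 0.
Proof. by move=> u0; apply: dotvv_eq0; rewrite -sqr_normv u0 expr0n. Qed.

Lemma dotv_row_perm (s : {perm 'I_n}) u v :
  dotv (row_perm s u) (row_perm s v) = dotv u v.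
Proof.
rewrite /dotv [RHS](reindex_inj (@perm_inj _ s)).
by apply: eq_bigr => i _; rewrite !mxE.
Qed.

Lemma dotv_delta a v : dotv (delta_mx a 0) v = v a 0.
Proof.
rewrite /dotv (bigD1 a)//= big1 ?addr0 => [|i /negbTE h]; rewrite mxE ?h ?eqxx.
  by rewrite mul1r.
by rewrite mul0r.
Qed.

Lemma sqr_entry_le u i : u i 0 ^+ 2 <= dotv u u.
Proof.
rewrite /dotv (bigD1 i)//= -expr2 lerDl.
by apply: sumr_ge0 => j _; rewrite -expr2 sqr_ge0.
Qed.

End DotProduct.

Section GramSchmidtTheory.
Variables (R : realType) (n : nat).
Implicit Types M : 'M[R]_n.

Lemma size_gram_schmidt (ys : seq 'cV[R]_n) : size (gram_schmidt ys) = size ys.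
Proof.
elim/last_ind: ys => // ys y IH.
by rewrite /gram_schmidt foldl_rcons !size_rcons; congr _.+1.
Qed.

Lemma take_gram_schmidt (ys : seq 'cV[R]_n) k :
  take k (gram_schmidt ys) = gram_schmidt (take k ys).
Proof.
have pre (zs ts : seq 'cV[R]_n) : take (size zs) (gram_schmidt (zs ++ ts)) = gram_schmidt zs.
  elim/last_ind: ts => [|ts t IH].
    by rewrite cats0 -[size zs]size_gram_schmidt take_size.
  rewrite -rcons_cat /gram_schmidt foldl_rcons -!/(gram_schmidt _) /gs_next -cats1 takel_cat//.
  by rewrite size_gram_schmidt size_cat leq_addr.
case: (leqP (size ys) k) => hk.
  by rewrite !take_oversize ?size_gram_schmidt.
rewrite -{1}(cat_take_drop k ys) -{1}(size_takel (ltnW hk)); exact: pre.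
Qed.

(** The index is a natural number, so that sums over [i < j] and strong induction need no casts
    between ordinals; from [n] on the value is the default [0]. *)
Definition gs M (i : nat) : 'cV[R]_n :=
  nth 0 (gram_schmidt [seq col j M | j <- enum 'I_n]) i.

Definition gs_proj M (j : nat) (y : 'cV[R]_n) : 'cV[R]_n :=
  \sum_(i < j) dotv y (gs M i) *: gs M i.

Definition gs_rest M (j : 'I_n) : 'cV[R]_n := col j M - gs_proj M j (col j M).

Lemma GS_matrixE M i j : GS_matrix M i j = gs M j i 0.
Proof. by rewrite mxE. Qed.

Lemma gsE M (j : 'I_n) : gs M j = (normv (gs_rest M j))^-1 *: gs_rest M j.
Proof.
set ys := [seq col k M | k <- enum 'I_n].
have sz : size ys = n by rewrite size_map size_enum_ord.
have yj : nth 0 ys j = col j M.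
  by rewrite (nth_map j) ?size_enum_ord// nth_ord_enum.
rewrite /gs -/ys -(nth_take 0 (ltnSn j)) take_gram_schmidt.
rewrite (take_nth 0) ?sz// /gram_schmidt foldl_rcons -!/(gram_schmidt _).
rewrite /gs_next -take_gram_schmidt nth_rcons size_take size_gram_schmidt sz ltn_ord ltnn eqxx.
have -> : \sum_(g <- take j (gram_schmidt ys)) dotv (nth 0 ys j) g *: g =
    gs_proj M j (col j M).
  rewrite (big_nth 0) size_take size_gram_schmidt sz ltn_ord big_mkord.
  by apply: eq_bigr => i _; rewrite nth_take// yj.
by rewrite yj.
Qed.

Lemma gs_restE M j : gs_rest M j = normv (gs_rest M j) *: gs M j.
Proof.
rewrite gsE scalerA; have [/normv_eq0 ->|h] := eqVneq (normv (gs_rest M j)) 0.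
  by rewrite scaler0.
by rewrite divff// scale1r.
Qed.

Lemma gs_normalized M (j : 'I_n) :
  dotv (gs M j) (gs M j) = (normv (gs_rest M j) != 0)%:R.
Proof.
rewrite gsE dotvZl dotvZr -sqr_normv.
have [->|h] := eqVneq (normv (gs_rest M j)) 0; first by rewrite invr0 mul0r.
by rewrite /=; field.
Qed.

Lemma gs_normalized01 M (j : 'I_n) v :
  dotv v (gs M j) * dotv (gs M j) (gs M j) = dotv v (gs M j).
Proof.
rewrite gs_normalized; have [h|h] := eqVneq (normv (gs_rest M j)) 0.
  by rewrite gsE h invr0 scale0r dotvC dotv0l mul0r.
by rewrite mulr1.
Qed.

(** Strong induction on the larger index: once the residual is expanded, only the term [l = i] of
    the projection survives, and it cancels the scalar product of the column with [gs M i]. *)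
Lemma gs_orthogonal M (i k : nat) : (i < n)%N -> (k < n)%N -> i != k ->
  dotv (gs M i) (gs M k) = 0.
Proof.
wlog ik : i k / (i < k)%N => [H hi hk|hi hk _].
  by rewrite neq_ltn => /orP[h|h]; [|rewrite dotvC]; apply: H => //; rewrite ?ltn_eqF.
elim/ltn_ind: k i ik hi hk => k IH i ik hi hk.
rewrite dotvC -[k]/(val (Ordinal hk)) gsE dotvZl dotvBl /gs_proj dotv_suml/=.
rewrite (bigD1 (Ordinal ik))//= big1 ?addr0; last first.
  move=> l /negbTE li; rewrite dotvZl.
  have hl : (l < n)%N by apply: ltn_trans hk.
  have : val l != i by apply: contraFN li => /eqP ?; apply/eqP/val_inj.
  rewrite neq_ltn => /orP[h|h]; first by rewrite (IH i)// mulr0.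
  by rewrite [dotv (gs M l) _]dotvC (IH l)// mulr0.
by rewrite dotvZl -[i]/(val (Ordinal hi)) gs_normalized01 subrr mulr0.
Qed.

Lemma dotv_gs_proj M (j i : nat) y : (j <= n)%N -> (i < n)%N ->
  dotv (gs_proj M j y) (gs M i) = if (i < j)%N then dotv y (gs M i) else 0.
Proof.
move=> jn hi; rewrite /gs_proj dotv_suml; case: ifPn => ij.
  rewrite (bigD1 (Ordinal ij))//= big1 ?addr0; last first.
    move=> l /negbTE li; rewrite dotvZl gs_orthogonal ?mulr0//.
      exact: leq_trans jn.
    by apply: contraFN li => /eqP ?; apply/eqP/val_inj.
  by rewrite dotvZl -[i]/(val (Ordinal hi)) gs_normalized01.
rewrite big1// => l _; rewrite dotvZl gs_orthogonal ?mulr0//.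
  exact: leq_trans jn.
by apply: contraNneq ij => <-.
Qed.

Lemma sqr_gs_proj M (j : nat) y : (j <= n)%N ->
  dotv (gs_proj M j y) (gs_proj M j y) = \sum_(i < j) dotv y (gs M i) ^+ 2.
Proof.
move=> jn; rewrite [X in dotv _ X]/gs_proj dotvC dotv_suml.
apply: eq_bigr => i _; rewrite dotvZl (dotvC (gs M i)) dotv_gs_proj//; last exact: leq_trans jn.
by rewrite ltn_ord expr2.
Qed.

Lemma sqr_dist_gs_proj M (j : nat) y : (j <= n)%N ->
  dotv (y - gs_proj M j y) (y - gs_proj M j y) =
  dotv y y - \sum_(i < j) dotv y (gs M i) ^+ 2.
Proof.
move=> jn; rewrite -(sqr_gs_proj M y jn).
have py : dotv y (gs_proj M j y) = dotv (gs_proj M j y) (gs_proj M j y).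
  rewrite sqr_gs_proj// dotvC dotv_suml.
  by apply: eq_bigr => i _; rewrite dotvZl dotvC -expr2.
rewrite dotvBl !dotvBr py dotvC py; ring.
Qed.

Definition gs_sqproj M (j : 'I_n) : R := \sum_(i < j) dotv (col j M) (gs M i) ^+ 2.

Definition gs_defect M (j : 'I_n) : R := Num.sqrt n%:R - normv (gs_rest M j).

Lemma sqr_normv_gs_rest M j :
  normv (gs_rest M j) ^+ 2 = dotv (col j M) (col j M) - gs_sqproj M j.
Proof. by rewrite sqr_normv sqr_dist_gs_proj// ltnW. Qed.

Lemma gs_bessel M (j : nat) y : (j <= n)%N ->
  \sum_(i < j) dotv y (gs M i) ^+ 2 <= dotv y y.
Proof. by move=> jn; rewrite -subr_ge0 -(sqr_dist_gs_proj M y jn) dotvv_ge0. Qed.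

(* The projection is self-adjoint, so an entry of the projection of [y] is a linear form
   in [y] with coefficients depending on the past only. *)
Lemma gs_proj_entry M (j : nat) y (a : 'I_n) :
  gs_proj M j y a 0 = dotv y (gs_proj M j (delta_mx a 0)).
Proof.
rewrite dotvC /gs_proj dotv_suml summxE; apply: eq_bigr => i _.
by rewrite mxE dotvZl dotv_delta mulrC dotvC.
Qed.

Lemma gs_row_le1 M (j : nat) (a : 'I_n) : (j <= n)%N ->
  \sum_(i < j) gs M i a 0 ^+ 2 <= 1.
Proof.
move=> jn; have := gs_bessel M (delta_mx a 0) jn; rewrite dotv_delta mxE !eqxx/=.
by under eq_bigr do rewrite dotv_delta.
Qed.

Definition gs_err M (j : 'I_n) : 'cV[R]_n := Num.sqrt n%:R *: gs M j - col j M.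

Lemma gs_errE M j : gs_err M j = gs_defect M j *: gs M j - gs_proj M j (col j M).
Proof.
have : gs_rest M j = normv (gs_rest M j) *: gs M j := gs_restE M j.
rewrite {1}/gs_rest /gs_err /gs_defect scalerBl => <-.
by rewrite opprB addrA addrAC addrK.
Qed.

(** This splitting yields the fourth moments of the entries of [gs M j]: those of the residual are
    bounded, and the defect term is controlled by exchangeability. *)
Lemma sqrtn_gsE M (j : 'I_n) :
  Num.sqrt n%:R *: gs M j = gs_rest M j + gs_defect M j *: gs M j.
Proof. by rewrite /gs_defect scalerBl -gs_restE addrC subrK. Qed.

Lemma sqr_gs_err M j : dotv (gs_err M j) (gs_err M j) =
  gs_defect M j ^+ 2 * dotv (gs M j) (gs M j) + gs_sqproj M j.
Proof.
have h : dotv (gs M j) (gs_proj M j (col j M)) = 0.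
  by rewrite dotvC dotv_gs_proj ?ltnn// ltnW.
have pp : dotv (gs_proj M j (col j M)) (gs_proj M j (col j M)) = gs_sqproj M j.
  exact: sqr_gs_proj (ltnW (ltn_ord j)).
rewrite gs_errE; move: h pp.
move: (gs_proj M j (col j M)) (gs M j) (gs_defect M j) (gs_sqproj M j) => v g D s h pp.
rewrite dotvBl !dotvBr !dotvZl !dotvZr (dotvC v g) h pp; ring.
Qed.

Lemma gs_sqproj_ge0 M j : 0 <= gs_sqproj M j.
Proof. by apply: sumr_ge0 => i _; exact: sqr_ge0. Qed.

Lemma eq_gs_proj M M' j y : (forall i, (i < j)%N -> gs M i = gs M' i) ->
  gs_proj M j y = gs_proj M' j y.
Proof. by move=> h; apply: eq_bigr => i _; rewrite h. Qed.

(** Gram-Schmidt is causal; this is the source of the independence of the vectors before [j] from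
    column [j]. *)
Lemma eq_gs M M' (b : nat) : (forall j : 'I_n, (j < b)%N -> col j M = col j M') ->
  forall i, (i < b)%N -> (i < n)%N -> gs M i = gs M' i.
Proof.
move=> h; elim/ltn_ind => i IH ib hi.
have e : gs_rest M (Ordinal hi) = gs_rest M' (Ordinal hi).
  rewrite /gs_rest h// (@eq_gs_proj M M')// => l li.
  by apply: IH => //; [exact: ltn_trans ib|exact: (ltn_trans (n := i))].
by rewrite -[i]/(val (Ordinal hi)) !gsE e.
Qed.

Lemma row_perm_scale (s : {perm 'I_n}) (c : R) (u : 'cV[R]_n) :
  row_perm s (c *: u) = c *: row_perm s u.
Proof. by apply/matrixP => i j; rewrite !mxE. Qed.

Lemma row_perm_gs_proj M (s : {perm 'I_n}) j y :
  (forall i, (i < j)%N -> gs (row_perm s M) i = row_perm s (gs M i)) ->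
  gs_proj (row_perm s M) j (row_perm s y) = row_perm s (gs_proj M j y).
Proof.
move=> h; rewrite /gs_proj; under eq_bigr do rewrite h// dotv_row_perm.
by apply/matrixP => a b; rewrite mxE !summxE; apply: eq_bigr => i _; rewrite !mxE.
Qed.

Lemma col_row_perm_mx M (s : {perm 'I_n}) j : col j (row_perm s M) = row_perm s (col j M).
Proof. by apply/matrixP => a b; rewrite !mxE. Qed.

(** Gram-Schmidt uses only linear combinations and scalar products, which row permutations respect.
    With the invariance of the law this makes the rows exchangeable. *)
Lemma gs_row_perm M (s : {perm 'I_n}) i : (i < n)%N ->
  gs (row_perm s M) i = row_perm s (gs M i).
Proof.
elim/ltn_ind: i => i IH hi.
have e : gs_rest (row_perm s M) (Ordinal hi) = row_perm s (gs_rest M (Ordinal hi)).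
  rewrite /gs_rest col_row_perm_mx row_perm_gs_proj; last first.
    by move=> l li; apply: IH => //; exact: (ltn_trans (n := i)).
  by apply/matrixP => a b; rewrite !mxE.
by rewrite -[i]/(val (Ordinal hi)) !gsE e /normv dotv_row_perm row_perm_scale.
Qed.

Lemma gs_rest_row_perm M (s : {perm 'I_n}) j :
  gs_rest (row_perm s M) j = row_perm s (gs_rest M j).
Proof.
rewrite /gs_rest col_row_perm_mx row_perm_gs_proj; last first.
  by move=> l li; apply: gs_row_perm; exact: ltn_trans (ltn_ord j).
by apply/matrixP => a b; rewrite !mxE.
Qed.

Lemma gs_defect_row_perm M s j : gs_defect (row_perm s M) j = gs_defect M j.
Proof. by rewrite /gs_defect gs_rest_row_perm /normv dotv_row_perm. Qed.

Lemma gs_err_row_perm M s j : gs_err (row_perm s M) j = row_perm s (gs_err M j).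
Proof.
rewrite /gs_err col_row_perm_mx gs_row_perm//.
by apply/matrixP => a b; rewrite !mxE.
Qed.

Lemma gs_entry_le1 M (j : 'I_n) a : `|gs M j a 0| <= 1.
Proof.
rewrite -(@expr_le1 _ 2)// real_normK ?num_real//.
apply: le_trans (sqr_entry_le _ a) _; rewrite gs_normalized.
by case: (_ != _).
Qed.

Lemma HS_distE p q M : HS_dist p q M = Num.sqrt
  (\sum_(i < n | (i < p)%N) \sum_(j < n | (j < q)%N) gs_err M j i 0 ^+ 2).
Proof.
congr Num.sqrt; apply: eq_bigr => i _; apply: eq_bigr => j _.
by rewrite GS_matrixE !mxE.
Qed.

End GramSchmidtTheory.

(** * Linear forms of Gaussian columns *)

Section NormalMomentsCombinatorics.
Variable R : realType.
Local Notation m_ := (normal_moment R).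

Lemma normal_moment_odd k : odd k -> m_ k = 0.
Proof.
elim/ltn_ind: k => -[//|k] IH; rewrite normal_moment_rec.
by case: k IH => [|k] IH /=; rewrite ?mul0r// negbK => ok; rewrite IH ?mulr0.
Qed.

Lemma normal_moment_even k : m_ k.*2 = (k.*2)`!%:R / (2 ^+ k * k`!%:R).
Proof.
elim: k => [|k IH]; first by rewrite normal_moment0 expr0 mul1r divr1.
rewrite doubleS normal_moment_rec /= IH.
have k0 : k`!%:R != 0 :> R by rewrite pnatr_eq0 -lt0n fact_gt0.
rewrite !factS !natrM exprS -[k.*2.+2%:R]natr1 -[k.*2.+1%:R]natr1 -[k.+1%:R]natr1.
rewrite -[k.*2]addnn natrD.
have k1 : k%:R + 1 != 0 :> R by rewrite natr1 pnatr_eq0.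
by field; rewrite k0 k1 expf_neq0.
Qed.

Lemma normal_moment2 : m_ 2 = 1.
Proof. by rewrite normal_moment_rec/= normal_moment0 mulr1. Qed.

Lemma normal_moment4 : m_ 4 = 3.
Proof. by rewrite normal_moment_rec/= normal_moment2 mulr1. Qed.

Lemma normal_moment8 : m_ 8 = 105.
Proof. by rewrite !(normal_moment_rec, normal_moment4)/= normal_moment0; ring. Qed.

(** The identity that turns the binomial expansion of a power of a sum of independent centred
    normals into the binomial expansion of a power of the sum of their variances. *)
Lemma normal_moment_conv k i : (i <= k)%N ->
  'C(k.*2, i.*2)%:R * m_ i.*2 * m_ (k - i).*2 = m_ k.*2 * 'C(k, i)%:R.
Proof.
move=> ik; rewrite !normal_moment_even.
have i2 : (i.*2 <= k.*2)%N by rewrite leq_double.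
have := bin_fact i2; rewrite -doubleB => e1; have := bin_fact ik => e2.
have -> : 2 ^+ k = 2 ^+ i * 2 ^+ (k - i) :> R by rewrite -exprD subnKC.
rewrite -e1 -e2 !natrM.
have f0 l : l`!%:R != 0 :> R by rewrite pnatr_eq0 -lt0n fact_gt0.
have b0 : 'C(k, i)%:R != 0 :> R by rewrite pnatr_eq0 -lt0n bin_gt0.
by field; rewrite !f0 b0 !expf_neq0.
Qed.

Lemma big_even_ord k (F : nat -> R) : (forall l, odd l -> F l = 0) ->
  \sum_(l < k.*2.+1) F l = \sum_(i < k.+1) F i.*2.
Proof.
move=> F0; elim: k => [|k IH]; first by rewrite !big_ord1.
rewrite doubleS big_ord_recr big_ord_recr/= IH [RHS]big_ord_recr/=.
by rewrite (F0 k.*2.+1) ?addr0//= odd_double.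
Qed.
End NormalMomentsCombinatorics.

Lemma sqr_sum_seq_le (R : realDomainType) I (r : seq I) (F : I -> R) :
  (\sum_(i <- r) F i) ^+ 2 <= (size r)%:R * \sum_(i <- r) F i ^+ 2.
Proof.
elim: r => [|i r IH]; first by rewrite !big_nil expr0n mul0r.
rewrite !big_cons /= -natr1.
(* The cross terms, bounded by summing [0 <= (F i - F j)^2] over [j]. *)
have H : 2 * F i * \sum_(j <- r) F j <= (size r)%:R * F i ^+ 2 + \sum_(j <- r) F j ^+ 2.
  elim: r {IH} => [|j r IH]; first by rewrite !big_nil mulr0 mul0r addr0.
  rewrite !big_cons /= -natr1; have := sqr_ge0 (F i - F j); nra.
nra.
Qed.

Lemma sqr_sum_ord_le (R : realDomainType) k (F : 'I_k -> R) :
  (\sum_i F i) ^+ 2 <= k%:R * \sum_i F i ^+ 2.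
Proof.
by apply: le_trans (sqr_sum_seq_le _ _) _; rewrite /index_enum -enumT size_enum_ord.
Qed.

Lemma measurable_sqrtr (R : realType) : measurable_fun setT (@Num.sqrt R).
Proof. by apply: continuous_measurable_fun; exact: sqrt_continuous. Qed.

Lemma tame_sqrt d (T : measurableType d) (R : realType) (P : probability T R) (f : T -> R) :
  tame P f -> tame P (fun x => Num.sqrt (f x)).
Proof.
move=> tf; have tg : tame P (fun x => 1 + `|f x|).
  by apply: tameD; [exact: tame_cst|exact: tame_normr].
apply: (tame_le _ tg); first by apply: measurableT_comp; [exact: measurable_sqrtr|case: tf].
move=> x; rewrite ger0_norm ?sqrtr_ge0// ger0_norm ?addr_ge0//.
have [f0|f0] := leP (f x) 0.
  by rewrite ler0_sqrtr// addr_ge0.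
rewrite gtr0_norm// -[X in _ <= _ + X](sqr_sqrtr (ltW f0)).
have := sqr_ge0 (Num.sqrt (f x) - 1); nra.
Qed.

Section GaussianMatrix.
Variables (R : realType) (n : nat).
Local Notation mxT := (mxT R n).
Variable nu : probability mxT R.
Hypothesis nuN : std_normal_mx nu.
Local Notation E := (Ex nu).

Definition indep_entry (f : mxT -> R) (a b : 'I_n) :=
  forall M x, f (mx_upd a b (x, M)) = f M.

(** Given coefficients that ignore column [j], the linear form is centred normal with variance the
    sum of their squares. The induction runs over the rows; the factor [H] absorbs the powers
    [g a ^+ l] split off by the binomial theorem. For odd [k] the truncated [k./2] is multiplied by
    a zero moment. *)
Lemma Ex_linear_form_pow (g : 'I_n -> mxT -> R) (j : 'I_n) :
  (forall a, tame nu (g a)) -> (forall a b, indep_entry (g a) b j) ->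
  forall (r : seq 'I_n) (H : mxT -> R) k, uniq r ->
  tame nu H -> (forall b, indep_entry H b j) ->
  E (fun M => H M * (\sum_(a <- r) M a j * g a M) ^+ k) =
  normal_moment R k * E (fun M => H M * (\sum_(a <- r) g a M ^+ 2) ^+ k./2).
Proof.
move=> tg ig r; elim: r => [|a r IH] H k /= => [_|/andP[ar ur]] tH iH.
  under eq_Ex do rewrite big_nil; under [in RHS]eq_Ex do rewrite big_nil.
  case: k => [|[|k]].
  - by rewrite normal_moment0 mul1r.
  - by rewrite normal_moment1 mul0r; under eq_Ex do rewrite expr1 mulr0; rewrite Ex_cst.
  - under eq_Ex do rewrite exprS mul0r mulr0.
    by under [in RHS]eq_Ex do rewrite /= exprS mul0r mulr0; rewrite Ex_cst mulr0.
have tS : tame nu (fun M => \sum_(a <- r) M a j * g a M).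
  by apply: tame_sum => b _; apply: tameM => //; exact: tame_entry.
have tG : tame nu (fun M => \sum_(a <- r) g a M ^+ 2).
  by apply: tame_sum => b _; exact: tameX.
have iS M x : \sum_(b <- r) mx_upd a j (x, M) b j * g b (mx_upd a j (x, M)) =
    \sum_(b <- r) M b j * g b M.
  apply: eq_big_seq => b br; rewrite ig; congr (_ * _).
  rewrite mxE eqxx andbT; case: eqP => // ba; by rewrite -ba br in ar.
(* The entry [(a, j)] is integrated out first; the induction hypothesis is then used with
   [H * g a ^+ l] in place of [H]. *)
have step l : E (fun M => H M * g a M ^+ l * (\sum_(a <- r) M a j * g a M) ^+ (k - l)
     * M a j ^+ l) =
   normal_moment R l * normal_moment R (k - l) *
     E (fun M => H M * g a M ^+ l * (\sum_(a <- r) g a M ^+ 2) ^+ (k - l)./2).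
  rewrite (@Ex_mul_entry _ _ _ nuN (fun M => H M * g a M ^+ l *
     (\sum_(a <- r) M a j * g a M) ^+ (k - l)) a j l).
  - rewrite -mulrA; congr (_ * _); apply: IH => //.
    + by apply: tameM => //; exact: tameX.
    + by move=> b M x; rewrite /= iH ig.
  - by apply: tameM; [apply: tameM => //; exact: tameX|exact: tameX].
  - by move=> M x; rewrite iS iH ig.
transitivity (\sum_(l < k.+1) 'C(k, l)%:R * (normal_moment R l * normal_moment R (k - l) *
     E (fun M => H M * g a M ^+ l * (\sum_(a <- r) g a M ^+ 2) ^+ (k - l)./2))).
  transitivity (E (fun M => \sum_(l < k.+1) 'C(k, l)%:R *
     (H M * g a M ^+ l * (\sum_(a <- r) M a j * g a M) ^+ (k - l) * M a j ^+ l))).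
    apply: eq_Ex => M; rewrite big_cons addrC exprDn mulr_sumr.
    by apply: eq_bigr => l _; rewrite -mulr_natl exprMn; ring.
  have t l : tame nu (fun M => H M * g a M ^+ l * (\sum_(a <- r) M a j * g a M) ^+ (k - l)
     * M a j ^+ l).
    apply: tameM; last by apply: tameX; exact: tame_entry.
    by apply: tameM; [apply: tameM => //; exact: tameX|exact: tameX].
  rewrite Ex_sum; last by move=> l _; exact: tameZ.
  by apply: eq_bigr => l _; rewrite ExZ// step.
(* For odd [k], one of [l] and [k - l] is odd in every term. *)
have [ok|ek] := boolP (odd k).
  rewrite (normal_moment_odd _ ok) mul0r big1// => l _.
  have [ol|el] := boolP (odd l).
    by rewrite (normal_moment_odd _ ol) !mul0r mulr0.
  rewrite [X in _ * (_ * X * _)]normal_moment_odd ?mulr0 ?mul0r ?mulr0//.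
  by rewrite oddB ?ok ?(negbTE el)// -ltnS.
have := odd_double_half k; rewrite (negbTE ek) add0n; set m := k./2 => e.
rewrite -{}e in ek step *.
rewrite (@big_even_ord _ m (fun l => 'C(m.*2, l)%:R * (normal_moment R l *
  normal_moment R (m.*2 - l) * E (fun M => H M * g a M ^+ l *
  (\sum_(a <- r) g a M ^+ 2) ^+ (m.*2 - l)./2)))); last first.
  by move=> l ol; rewrite (normal_moment_odd _ ol) !mul0r mulr0.
transitivity (normal_moment R m.*2 * E (fun M => \sum_(i < m.+1) 'C(m, i)%:R *
   (H M * g a M ^+ i.*2 * (\sum_(a <- r) g a M ^+ 2) ^+ (m - i)))); last first.
  congr (_ * _); apply: eq_Ex => M; rewrite big_cons addrC exprDn mulr_sumr.
  by apply: eq_bigr => i _; rewrite -mulr_natl -exprM mul2n; ring.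
rewrite Ex_sum; last first.
  by move=> i _; apply: tameZ; apply: tameM; [apply: tameM => //; exact: tameX|exact: tameX].
rewrite mulr_sumr; apply: eq_bigr => i _; rewrite ExZ; last first.
  by apply: tameM; [apply: tameM => //; exact: tameX|exact: tameX].
have im : (i <= m)%N by rewrite -ltnS.
by rewrite -doubleB doubleK !mulrA normal_moment_conv.
Qed.

End GaussianMatrix.

(** * Projections on the previous vectors *)

Section GaussianGramSchmidt.
Variables (R : realType) (n : nat).
Local Notation mxT := (mxT R n).
Variable nu : probability mxT R.
Hypothesis nuN : std_normal_mx nu.
Local Notation E := (Ex nu).
Implicit Types (i j : 'I_n).

Definition tamev (F : mxT -> 'cV[R]_n) := forall a, tame nu (fun M => F M a 0).

Lemma tame_dotv F G : tamev F -> tamev G -> tame nu (fun M => dotv (F M) (G M)).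
Proof. by move=> tF tG; apply: tame_sum => i _; exact: tameM. Qed.

Lemma tame_normv F : tamev F -> tame nu (fun M => normv (F M)).
Proof. by move=> tF; apply: tame_sqrt; exact: tame_dotv. Qed.

Lemma tamevZ f F : tame nu f -> tamev F -> tamev (fun M => f M *: F M).
Proof. by move=> tf tF a; under eq_fun do rewrite mxE; exact: tameM. Qed.

Lemma tamevB F G : tamev F -> tamev G -> tamev (fun M => F M - G M).
Proof. by move=> tF tG a; under eq_fun do rewrite !mxE; exact: tameB. Qed.

Lemma tamev_sum k (F : 'I_k -> mxT -> 'cV[R]_n) : (forall i : 'I_k, tamev (F i)) ->
  tamev (fun M => \sum_(i < k) F i M).
Proof. by move=> tF a; under eq_fun do rewrite summxE; apply: tame_sum => i _; exact: tF. Qed.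

Lemma tamev_col j : tamev (fun M => col j M).
Proof. by move=> a; under eq_fun do rewrite mxE; exact: tame_entry. Qed.

Lemma measurable_inv_normv (F : mxT -> 'cV[R]_n) : tamev F ->
  measurable_fun setT (fun M => (normv (F M))^-1).
Proof.
move=> /tame_normv [mF _].
under eq_fun do rewrite -powR_inv1 ?normv_ge0//.
by apply: (measurableT_comp (measurable_powR _) mF).
Qed.

(** Restricted to a prefix because the induction in [tamev_gs] knows only the earlier vectors. *)
Lemma tamev_gs_proj_prefix (k : nat) : (forall i : nat, (i < k)%N -> tamev (fun M => gs M i)) ->
  forall F, tamev F -> tamev (fun M => gs_proj M k (F M)).
Proof.
move=> tg F tF; apply: tamev_sum => i.
by apply: tamevZ; [apply: tame_dotv => //|]; exact: tg.
Qed.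

(** Of the inverse norm only measurability is required: the moments exist because the entries are
    bounded by 1, so no negative moment of a norm appears. *)
Lemma tamev_gs (k : nat) : (k < n)%N -> tamev (fun M => gs M k).
Proof.
elim/ltn_ind: k => k IH hk.
have tr : tamev (fun M => gs_rest M (Ordinal hk)).
  apply: tamevB; first exact: tamev_col.
  apply: tamev_gs_proj_prefix; last exact: tamev_col.
  by move=> i ik; apply: IH => //; exact: (ltn_trans (n := k)).
move=> a; apply: (tame_le _ (tame_cst nu 1)); last first.
  by move=> M; rewrite normr1 -[k]/(val (Ordinal hk)) gs_entry_le1.
rewrite -[k]/(val (Ordinal hk)); under eq_fun do rewrite gsE mxE.
by apply: measurable_funM; [exact: measurable_inv_normv|case: (tr a)].
Qed.

Lemma tamev_gs_proj j F : tamev F -> tamev (fun M => gs_proj M j (F M)).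
Proof. by apply: tamev_gs_proj_prefix => i ij; apply: tamev_gs; exact: ltn_trans (ltn_ord j). Qed.

Lemma tamev_gs_rest j : tamev (fun M => gs_rest M j).
Proof. by apply: tamevB; [|apply: tamev_gs_proj]; exact: tamev_col. Qed.

Lemma tame_gs_defect j : tame nu (fun M => gs_defect M j).
Proof. by apply: tameB; [exact: tame_cst|apply: tame_normv; exact: tamev_gs_rest]. Qed.

Lemma tamev_gs_err j : tamev (fun M => gs_err M j).
Proof.
apply: tamevB; last exact: tamev_col.
by apply: tamevZ; [exact: tame_cst|exact: tamev_gs].
Qed.

Lemma tame_gs_sqproj j : tame nu (fun M => gs_sqproj M j).
Proof.
apply: tame_sum => i _; apply: tameX; apply: tame_dotv; first exact: tamev_col.
by apply: tamev_gs; exact: ltn_trans (ltn_ord j).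
Qed.

Lemma indep_entry_gs (k : nat) j a b : (k < j)%N -> indep_entry (fun M : 'M[R]_n => gs M k a 0) b j.
Proof.
move=> kj M x; congr (fun_of_matrix _ a 0).
apply: (@eq_gs _ _ _ _ j) => //; last exact: ltn_trans (ltn_ord j).
move=> l lj; apply/matrixP => c e; rewrite !mxE/=.
by case: eqP => //= _; case: eqP => // lj'; rewrite lj' ltnn in lj.
Qed.

Lemma Ex_col_dotv_pow j (g : mxT -> 'cV[R]_n) (H : mxT -> R) k : tamev g ->
  (forall a b, indep_entry (fun M => g M a 0) b j) ->
  tame nu H -> (forall b, indep_entry H b j) ->
  E (fun M => H M * dotv (col j M) (g M) ^+ k) =
  normal_moment R k * E (fun M => H M * dotv (g M) (g M) ^+ k./2).
Proof.
move=> tg ig tH iH.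
have := Ex_linear_form_pow nuN (g := fun a M => g M a 0) tg ig k
  (index_enum_uniq 'I_n) tH iH.
rewrite (_ : (fun M => _) = (fun M => H M * dotv (col j M) (g M) ^+ k)); last first.
  apply/funext => M; congr (_ * _ ^+ _).
  by apply: eq_bigr => a _; rewrite mxE.
by move=> ->; congr (_ * _); apply: eq_Ex.
Qed.

(* The probability that [gs M j = 0]. *)
Definition gs_rank_defect j := E (fun M => 1 - dotv (gs M j) (gs M j)).

Lemma Ex_sq_coef j (k : nat) (kj : (k < j)%N) (kn : (k < n)%N) :
  E (fun M => dotv (col j M) (gs M k) ^+ 2) = 1 - gs_rank_defect (Ordinal kn).
Proof.
have := @Ex_col_dotv_pow j (fun M => gs M k) (fun=> 1) 2 (tamev_gs kn)
  (fun a b => @indep_entry_gs k j a b kj) (tame_cst _ _) (fun _ _ _ => erefl).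
rewrite normal_moment2 mul1r.
under eq_Ex do rewrite mul1r; move=> ->; under eq_Ex do rewrite mul1r expr1.
rewrite /gs_rank_defect ExB; last 2 first.
- exact: tame_cst.
- by apply: tame_dotv; exact: tamev_gs.
by rewrite Ex_cst opprB addrC subrK.
Qed.

Lemma Ex_coef_pow_le j (k : nat) m : (k < j)%N ->
  E (fun M => dotv (col j M) (gs M k) ^+ m.*2) <= normal_moment R m.*2.
Proof.
move=> kj; have kn : (k < n)%N by exact: ltn_trans (ltn_ord j).
have := @Ex_col_dotv_pow j (fun M => gs M k) (fun=> 1) m.*2 (tamev_gs kn)
  (fun a b => @indep_entry_gs k j a b kj) (tame_cst _ _) (fun _ _ _ => erefl).
under eq_Ex do rewrite mul1r; move=> ->; rewrite doubleK.
rewrite -[leRHS]mulr1 ler_wpM2l//.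
  by rewrite normal_moment_even divr_ge0 ?mulr_ge0 ?exprn_ge0.
rewrite -[leRHS](Ex_cst nu); apply: le_Ex.
- by apply: tameM; [exact: tame_cst|apply: tameX; apply: tame_dotv; exact: tamev_gs].
- exact: tame_cst.
- move=> M; rewrite mul1r -[k]/(val (Ordinal kn)) gs_normalized.
  by case: (_ != _); rewrite ?expr1n// expr0n; case: (m == 0%N).
Qed.

Lemma Ex_sum_coef_pow_le j m :
  E (fun M => \sum_(i < j) dotv (col j M) (gs M i) ^+ m.*2) <= j%:R * normal_moment R m.*2.
Proof.
rewrite Ex_sum; last first.
  move=> i _; apply: tameX; apply: tame_dotv; first exact: tamev_col.
  by apply: tamev_gs; exact: ltn_trans (ltn_ord j).
apply: (@le_trans _ _ (\sum_(i < j) normal_moment R m.*2)).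
  by apply: ler_sum => i _; exact: Ex_coef_pow_le.
by rewrite sumr_const card_ord mulr_natl.
Qed.

Let tame_sum_coef j m : tame nu (fun M => \sum_(i < j) dotv (col j M) (gs M i) ^+ m).
Proof.
apply: tame_sum => i _; apply: tameX; apply: tame_dotv; first exact: tamev_col.
by apply: tamev_gs; exact: ltn_trans (ltn_ord j).
Qed.

Lemma Ex_sqproj1 j : E (fun M => gs_sqproj M j) <= j%:R.
Proof. by have := Ex_sum_coef_pow_le j 1; rewrite normal_moment2 mulr1. Qed.

(** Cauchy-Schwarz over the [j] coefficients already gives the right order; 3 is the fourth normal
    moment. *)
Lemma Ex_sqproj2 j : E (fun M => gs_sqproj M j ^+ 2) <= 3 * j%:R ^+ 2.
Proof.
apply: (@le_trans _ _ (E (fun M => j%:R * \sum_(i < j) dotv (col j M) (gs M i) ^+ 4))).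
  apply: le_Ex; [by apply: tameX; exact: tame_gs_sqproj|exact: tameZ|].
  move=> M; apply: le_trans (sqr_sum_ord_le _) _.
  by under eq_bigr do rewrite -exprM.
rewrite ExZ//; apply: le_trans (ler_wpM2l (ler0n _ _) (Ex_sum_coef_pow_le j 2)) _.
by rewrite (normal_moment4 R : normal_moment R 2.*2 = 3) mulrA -expr2 mulrC.
Qed.

(** Cauchy-Schwarz twice; 105 is the eighth normal moment. *)
Lemma Ex_sqproj4 j : E (fun M => gs_sqproj M j ^+ 4) <= 105 * j%:R ^+ 4.
Proof.
apply: (@le_trans _ _ (E (fun M => j%:R ^+ 3 * \sum_(i < j) dotv (col j M) (gs M i) ^+ 8))).
  apply: le_Ex; [by apply: tameX; exact: tame_gs_sqproj|exact: tameZ|].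
  move=> M; rewrite (exprM _ 2 2).
  apply: (@le_trans _ _ ((j%:R * \sum_(i < j) dotv (col j M) (gs M i) ^+ 4) ^+ 2)).
    rewrite lerXn2r ?nnegrE ?exprn_ge0 ?gs_sqproj_ge0//.
      by rewrite mulr_ge0// sumr_ge0// => i _; rewrite exprn_even_ge0.
    apply: le_trans (sqr_sum_ord_le _) _.
    by under eq_bigr do rewrite -exprM.
  rewrite exprMn (exprSr _ 2) -mulrA ler_wpM2l ?exprn_ge0//.
  apply: le_trans (sqr_sum_ord_le _) _.
  by under eq_bigr do rewrite -exprM.
rewrite ExZ//; apply: le_trans (ler_wpM2l (exprn_ge0 _ (ler0n _ _)) (Ex_sum_coef_pow_le j 4)) _.
by rewrite (normal_moment8 R : normal_moment R 4.*2 = 105) mulrA -exprSr mulrC.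
Qed.

End GaussianGramSchmidt.

(** * Norms of the columns *)

Section ChiSquare.
Variables (R : realType) (n : nat).
Local Notation mxT := (mxT R n).
Variable nu : probability mxT R.
Hypothesis nuN : std_normal_mx nu.
Local Notation E := (Ex nu).
Implicit Types (i j : 'I_n).

(** [E (X^2 - 1)^k] for a standard normal [X], by the binomial theorem. *)
Definition centered_sq_moment (k : nat) : R :=
  \sum_(i < k.+1) 'C(k, i)%:R * (-1) ^+ i * normal_moment R (k - i).*2.

Lemma centered_sq_moment0 : centered_sq_moment 0 = 1.
Proof. by rewrite /centered_sq_moment big_ord1/= normal_moment0 !mul1r. Qed.

Lemma normal_moment6 : normal_moment R 6 = 15.
Proof. by rewrite normal_moment_rec /= normal_moment4; ring. Qed.

Let mE := (normal_moment0 R : normal_moment R 0.*2 = 1,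
  normal_moment2 R : normal_moment R 1.*2 = 1, normal_moment4 R : normal_moment R 2.*2 = 3,
  normal_moment6 : normal_moment R 3.*2 = 15, normal_moment8 R : normal_moment R 4.*2 = 105).
Let binE := (bin0, bin1, binn, erefl : 'C(3, 2) = 3%N, erefl : 'C(4, 2) = 6%N,
  erefl : 'C(4, 3) = 4%N).

Lemma centered_sq_moment1 : centered_sq_moment 1 = 0.
Proof.
rewrite /centered_sq_moment !big_ord_recr big_ord0/= ?subSS !subn0 !binE !mE; ring.
Qed.

Lemma centered_sq_moment2 : centered_sq_moment 2 = 2.
Proof.
rewrite /centered_sq_moment !big_ord_recr big_ord0/= ?subSS !subn0 !binE !mE; ring.
Qed.

Lemma centered_sq_moment3 : centered_sq_moment 3 = 8.
Proof.
rewrite /centered_sq_moment !big_ord_recr big_ord0/= ?subSS !subn0 !binE !mE; ring.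
Qed.

Lemma centered_sq_moment4 : centered_sq_moment 4 = 60.
Proof.
rewrite /centered_sq_moment !big_ord_recr big_ord0/= ?subSS !subn0 !binE !mE; ring.
Qed.

Lemma Ex_mul_centered_sq (f : mxT -> R) a b k : tame nu f -> indep_entry f a b ->
  E (fun M => f M * (M a b ^+ 2 - 1) ^+ k) = centered_sq_moment k * E f.
Proof.
move=> tf If; transitivity (E (fun M => \sum_(i < k.+1)
    ('C(k, i)%:R * (-1) ^+ i) * (f M * M a b ^+ (k - i).*2))).
  apply: eq_Ex => M; rewrite exprDn mulr_sumr; apply: eq_bigr => i _.
  by rewrite -mulr_natl -exprM mul2n; ring.
have t (i : 'I_k.+1) : tame nu (fun M => f M * M a b ^+ (k - i).*2).
  by apply: tameM => //; apply: tameX; exact: tame_entry.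
rewrite Ex_sum; last by move=> i _; exact: tameZ.
rewrite mulr_suml; apply: eq_bigr => i _; rewrite ExZ//.
by rewrite (Ex_mul_entry nuN) ?mulrA.
Qed.

Definition col_dev (M : 'M[R]_n) j := dotv (col j M) (col j M) - n%:R.

Lemma col_devE M j : col_dev M j = \sum_a (M a j ^+ 2 - 1).
Proof.
rewrite /col_dev /dotv sumrB sumr_const card_ord; congr (_ - _).
by apply: eq_bigr => a _; rewrite mxE expr2.
Qed.

Let T (r : seq 'I_n) j (M : mxT) := \sum_(a <- r) (M a j ^+ 2 - 1).

Let tT r j : tame nu (T r j).
Proof.
apply: tame_sum => a _; apply: tameB; last exact: tame_cst.
by apply: tameX; exact: tame_entry.
Qed.

Let ET_cons a r j k : uniq (a :: r) -> E (fun M => T (a :: r) j M ^+ k) =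
  \sum_(l < k.+1) 'C(k, l)%:R * (centered_sq_moment l * E (fun M => T r j M ^+ (k - l))).
Proof.
move=> /= /andP[ar ur].
have iT l : indep_entry (fun M => T r j M ^+ l) a j.
  move=> M x; congr (_ ^+ _); apply: eq_big_seq => b br; rewrite mxE/= eqxx andbT.
  by case: eqP => // ba; rewrite -ba br in ar.
transitivity (E (fun M => \sum_(l < k.+1)
    'C(k, l)%:R * (T r j M ^+ (k - l) * (M a j ^+ 2 - 1) ^+ l))).
  apply: eq_Ex => M; rewrite /T big_cons addrC exprDn.
  by apply: eq_bigr => l _; rewrite -mulr_natl.
have t l : tame nu (fun M => T r j M ^+ (k - l) * (M a j ^+ 2 - 1) ^+ l).
  apply: tameM; first exact: tameX.
  by apply: tameX; apply: tameB; [apply: tameX; exact: tame_entry|exact: tame_cst].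
rewrite Ex_sum; last by move=> l _; exact: tameZ.
apply: eq_bigr => l _; rewrite ExZ// Ex_mul_centered_sq//; exact: tameX.
Qed.

(** Moments of a centred chi-square variable, proved jointly because adding one entry expresses each
    of them through the lower ones. The third serves the lower bound on the mean of
    [gs_defect ^+ 2], the fourth the upper bound on that of [gs_defect ^+ 4]. *)
Let ET r j : uniq r -> [/\ E (T r j) = 0, E (fun M => T r j M ^+ 2) = 2 * (size r)%:R,
  E (fun M => T r j M ^+ 3) = 8 * (size r)%:R &
  E (fun M => T r j M ^+ 4) = 12 * (size r)%:R ^+ 2 + 48 * (size r)%:R].
Proof.
elim: r => [_|a r IH] .
  rewrite /T; split; rewrite -[RHS]addr0.
  - by under eq_Ex do rewrite big_nil; rewrite Ex_cst addr0.
  - by under eq_Ex do rewrite big_nil expr0n; rewrite Ex_cst/= mulr0 addr0.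
  - by under eq_Ex do rewrite big_nil expr0n; rewrite Ex_cst/= mulr0 addr0.
  - by under eq_Ex do rewrite big_nil expr0n; rewrite Ex_cst/= expr0n/= !mulr0 !addr0.
move=> uar; have /andP[_ /IH[e1 e2 e3 e4]] := uar.
have E0 : E (fun M => T r j M ^+ 0) = 1 by under eq_Ex do rewrite expr0; rewrite Ex_cst.
have E1 : E (fun M => T r j M ^+ 1) = 0 by under eq_Ex do rewrite expr1.
have C := (centered_sq_moment0, centered_sq_moment1, centered_sq_moment2,
  centered_sq_moment3, centered_sq_moment4).
split.
- transitivity (E (fun M => T (a :: r) j M ^+ 1)); first by under [RHS]eq_Ex do rewrite expr1.
  by rewrite ET_cons// !big_ord_recr big_ord0/= !C !subnn !subn0 E0 E1; ring.
- rewrite ET_cons// !big_ord_recr big_ord0/= !C ?subSS !subn0 !binE E0 E1 e2 -natr1; ring.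
- rewrite ET_cons// !big_ord_recr big_ord0/= !C ?subSS !subn0 !binE E0 E1 e2 e3 -natr1; ring.
- rewrite ET_cons// !big_ord_recr big_ord0/= !C ?subSS !subn0 !binE E0 E1 e2 e3 e4 -natr1; ring.
Qed.

Lemma tame_col_dev j : tame nu (fun M => col_dev M j).
Proof. by under eq_fun do rewrite col_devE; exact: tT. Qed.

Let ETall j := ET j (index_enum_uniq 'I_n).
Let szn : size (index_enum 'I_n) = n.
Proof. by rewrite /index_enum -enumT size_enum_ord. Qed.

Lemma Ex_col_dev2 j : E (fun M => col_dev M j ^+ 2) = 2 * n%:R.
Proof. by under eq_Ex do rewrite col_devE; case: (ETall j); rewrite szn. Qed.

Lemma Ex_col_dev3 j : E (fun M => col_dev M j ^+ 3) = 8 * n%:R.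
Proof. by under eq_Ex do rewrite col_devE; case: (ETall j); rewrite szn. Qed.

Lemma Ex_col_dev4 j : E (fun M => col_dev M j ^+ 4) <= 60 * n%:R ^+ 2.
Proof.
under eq_Ex do rewrite col_devE; case: (ETall j) => _ _ _; rewrite szn => ->.
have : 1 <= n%:R :> R by rewrite ler1n; case: n j => // -[].
by nra.
Qed.

End ChiSquare.

(** * Errors of the columns *)

Section RealInequalities.
Variable R : realFieldType.
Implicit Types x y m t N : R.

Lemma ler_sqr x y : 0 <= x -> x <= y -> x ^+ 2 <= y ^+ 2.
Proof. by move=> x0 xy; rewrite lerXn2r// nnegrE// (le_trans x0). Qed.

Lemma sqrD_le x y : (x + y) ^+ 2 <= 2 * x ^+ 2 + 2 * y ^+ 2.
Proof. by have := sqr_ge0 (x - y); nra. Qed.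

Lemma exprD4_le x y : (x + y) ^+ 4 <= 8 * x ^+ 4 + 8 * y ^+ 4.
Proof.
rewrite !(exprM _ 2 2).
apply: le_trans (ler_sqr (sqr_ge0 _) (sqrD_le x y)) _.
apply: le_trans (sqrD_le _ _) _; rewrite !exprMn.
by rewrite le_eqVlt; apply/orP; left; apply/eqP; ring.
Qed.

Lemma exprB4_le x y : (x - y) ^+ 4 <= 8 * x ^+ 4 + 8 * y ^+ 4.
Proof. by apply: le_trans (exprD4_le _ _) _; rewrite (exprNn y) -signr_odd expr0 mul1r. Qed.

(** [t^2 - N = (t - m) (t + m)] with [t + m >= m]. This trades the square roots in [gs_defect] for
    the polynomial [|w_j|^2 - n]. *)
Lemma sqr_dist_root_le N m t : m ^+ 2 = N -> 0 <= m -> 0 <= t ->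
  N * (m - t) ^+ 2 <= (t ^+ 2 - N) ^+ 2.
Proof.
move=> <- m0 t0.
have -> : (t ^+ 2 - m ^+ 2) ^+ 2 = (m + t) ^+ 2 * (m - t) ^+ 2 by ring.
by rewrite ler_wpM2r ?sqr_ge0// ler_sqr// lerDl.
Qed.

(* Third-order lower bound from the Taylor expansion of [sqrt] at [N] *)
Lemma sqr_dist_root_ge N m t : m ^+ 2 = N -> 0 <= m -> 0 <= t ->
  2 * N * (t ^+ 2 - N) ^+ 2 - (t ^+ 2 - N) ^+ 3 <= 8 * N ^+ 2 * (m - t) ^+ 2.
Proof.
move=> <- m0 t0; rewrite -subr_ge0.
have -> : 8 * (m ^+ 2) ^+ 2 * (m - t) ^+ 2 - (2 * m ^+ 2 * (t ^+ 2 - m ^+ 2) ^+ 2 -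
  (t ^+ 2 - m ^+ 2) ^+ 3) = ((m - t) ^+ 2) ^+ 2 * (t ^+ 2 + 4 * t * m + 5 * m ^+ 2) by ring.
by rewrite mulr_ge0 ?sqr_ge0// !addr_ge0 ?mulr_ge0 ?sqr_ge0.
Qed.

End RealInequalities.

Ltac tame_tac := repeat first [assumption | exact: tame_cst | apply: tameX |
  apply: tameM | apply: tameB | apply: tameD].

Section ErrorMoments.
Variables (R : realType) (n : nat).
Local Notation mxT := (mxT R n).
Variable nu : probability mxT R.
Hypothesis nuN : std_normal_mx nu.
Local Notation E := (Ex nu).
Implicit Types (i j a b : 'I_n).

Lemma Ex_exchangeable (f : mxT -> 'I_n -> R) :
  (forall a, tame nu (fun M => f M a)) ->
  (forall s M a, f (mx_rperm s M) a = f M (s a)) ->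
  forall a b, E (fun M => f M a) = E (fun M => f M b).
Proof.
move=> tf fs a b; rewrite -(Ex_rperm nuN (tperm a b) (tf a)).
by apply: eq_Ex => M; rewrite fs tpermL.
Qed.

(** Replaces one row by [1/n] times the sum over all rows, where column norms appear. *)
Lemma Ex_exchangeable_sum (f : mxT -> 'I_n -> R) :
  (forall a, tame nu (fun M => f M a)) ->
  (forall s M a, f (mx_rperm s M) a = f M (s a)) ->
  forall a, n%:R * E (fun M => f M a) = E (fun M => \sum_b f M b).
Proof.
move=> tf fs a; rewrite Ex_sum//.
rewrite (eq_bigr (fun=> E (fun M => f M a))); last by move=> b _; exact: Ex_exchangeable.
by rewrite sumr_const card_ord mulr_natl.
Qed.

Lemma col_devB (M : 'M[R]_n) j :
  col_dev M j - gs_sqproj M j = normv (gs_rest M j) ^+ 2 - n%:R.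
Proof. by rewrite sqr_normv_gs_rest /col_dev; ring. Qed.

Lemma sqr_gs_defect_le (M : 'M[R]_n) j :
  n%:R * gs_defect M j ^+ 2 <= (col_dev M j - gs_sqproj M j) ^+ 2.
Proof.
rewrite col_devB; apply: sqr_dist_root_le; [exact: sqr_sqrtr|exact: sqrtr_ge0|].
exact: normv_ge0.
Qed.

Lemma sqr_gs_defect_ge (M : 'M[R]_n) j :
  2 * n%:R * (col_dev M j - gs_sqproj M j) ^+ 2 - (col_dev M j - gs_sqproj M j) ^+ 3
  <= 8 * n%:R ^+ 2 * gs_defect M j ^+ 2.
Proof.
rewrite col_devB; apply: sqr_dist_root_ge; [exact: sqr_sqrtr|exact: sqrtr_ge0|].
exact: normv_ge0.
Qed.

Lemma natr_ord_gt0 j : 0 < n%:R :> R.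
Proof. by rewrite ltr0n; case: n j => // -[]. Qed.

(** [1320 = 8 * (60 + 105)], from [exprB4_le], [Ex_col_dev4] and [Ex_sqproj4]; [B] stands for a
    bound on [j^2 / n]. *)
Definition defect4_bound (B : R) := 1320 * B ^+ 2.

Lemma defect4_bound_ge0 B : 0 <= defect4_bound B.
Proof. by rewrite mulr_ge0 ?ler0n ?sqr_ge0. Qed.

Lemma Ex_gs_defect4 (B : R) j : 1 <= B -> j%:R ^+ 2 <= B * n%:R ->
  E (fun M => gs_defect M j ^+ 4) <= defect4_bound B.
Proof.
rewrite /defect4_bound.
move=> B1 jB; have n0 := natr_ord_gt0 j.
have tD := tame_gs_defect nuN j; have ts := tame_gs_sqproj nuN j; have tA := tame_col_dev nuN j.
have : E (fun M => n%:R ^+ 2 * gs_defect M j ^+ 4) <=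
    E (fun M => 8 * col_dev M j ^+ 4 + 8 * gs_sqproj M j ^+ 4).
  apply: le_Ex; [tame_tac|tame_tac|] => M.
  rewrite (exprM (gs_defect M j) 2 2) -exprMn.
  apply: le_trans (ler_sqr _ (sqr_gs_defect_le M j)) _.
    by rewrite mulr_ge0// sqr_ge0.
  by rewrite -exprM; exact: exprB4_le.
rewrite ExZ; last exact: tameX.
rewrite ExD; [|by apply: tameZ; exact: tameX|by apply: tameZ; exact: tameX].
rewrite !ExZ; [|exact: tameX|exact: tameX].
have := Ex_col_dev4 nuN j; have := Ex_sqproj4 nuN j.
move: (E (fun M => gs_defect M j ^+ 4)) (E _) (E _) => x y z hy hz h.
have j4 : j%:R ^+ 4 <= B ^+ 2 * n%:R ^+ 2.
  by rewrite (exprM _ 2 2) -exprMn ler_sqr// sqr_ge0.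
rewrite -(ler_pM2l (exprn_gt0 2 n0)).
have B2 : 1 <= B ^+ 2 by rewrite expr_ge1// (le_trans _ B1).
have := exprn_gt0 2 n0; move: B2 j4 hy hz h.
move: (n%:R ^+ 2) (B ^+ 2) (j%:R ^+ 4) => N b J b1 h1 h2 h3 h4 N0.
nra.
Qed.

(** [10 = 2 * 2 + 2 * 3], from [Ex_col_dev2] and [Ex_sqproj2]. *)
Lemma Ex_gs_defect2 (B : R) j : 1 <= B -> j%:R ^+ 2 <= B * n%:R ->
  E (fun M => gs_defect M j ^+ 2) <= 10 * B.
Proof.
move=> B1 jB; have n0 := natr_ord_gt0 j.
have tD := tame_gs_defect nuN j; have ts := tame_gs_sqproj nuN j; have tA := tame_col_dev nuN j.
have : E (fun M => n%:R * gs_defect M j ^+ 2) <=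
    E (fun M => 2 * col_dev M j ^+ 2 + 2 * gs_sqproj M j ^+ 2).
  apply: le_Ex; [by apply: tameZ; exact: tameX|
    by apply: tameD; apply: tameZ; exact: tameX|] => M.
  apply: le_trans (sqr_gs_defect_le M j) _.
  have := sqr_ge0 (col_dev M j + gs_sqproj M j); nra.
rewrite ExZ; last exact: tameX.
rewrite ExD; [|by apply: tameZ; exact: tameX|by apply: tameZ; exact: tameX].
rewrite !ExZ; [|exact: tameX|exact: tameX].
rewrite (Ex_col_dev2 nuN); have := Ex_sqproj2 nuN j.
move: (E (fun M => gs_defect M j ^+ 2)) (E _) => x y hy h.
rewrite -(ler_pM2l n0); nra.
Qed.

(** With [A = col_dev] and [s = gs_sqproj], the leading term [2 n A^2] of [sqr_gs_defect_ge] has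
    mean [4 n^2], which is 1/2 after division by [8 n^2]. As [A] and [s] are dependent, the products
    [A s] and [A s^2] are split by weighted AM-GM inequalities; [j.+1] in place of [j] keeps the
    weights positive. *)
Lemma Ex_gs_defect2_ge (B : R) j : 1 <= B -> j.+1%:R ^+ 2 <= B * n%:R ->
  2^-1 - 24 * B * j.+1%:R / Num.sqrt n%:R <= E (fun M => gs_defect M j ^+ 2).
Proof.
move=> B1 jB; have n0 := natr_ord_gt0 j.
have tD := tame_gs_defect nuN j; have ts := tame_gs_sqproj nuN j; have tA := tame_col_dev nuN j.
set m : R := Num.sqrt n%:R.
have m0 : 0 < m by rewrite sqrtr_gt0.
have mn : m ^+ 2 = n%:R by rewrite sqr_sqrtr// ltW.
set k : R := j.+1%:R.
have k1 : 1 <= k by rewrite ler1n.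
have jk : j%:R <= k by rewrite ler_nat.
(* These weights balance [E A^2 = 2 m^2] against [E s^2 = O(k^2)] for [l], and against
   [E s^4 = O(k^4)] for [l2]. *)
pose l := k / m; pose l2 := k ^+ 2 / m.
have l0 : 0 < l by rewrite divr_gt0// (lt_le_trans _ k1).
have l20 : 0 < l2 by rewrite divr_gt0// exprn_gt0// (lt_le_trans _ k1).
have amgm (c x y : R) : 0 < c -> x * y <= 2^-1 * c * x ^+ 2 + 2^-1 / c * y ^+ 2.
  move=> c0; have := sqr_ge0 (c * x - y); rewrite -(pmulr_rge0 _ (ltac:(rewrite invr_gt0; exact: c0) : 0 < c^-1)).
  have -> : c^-1 * (c * x - y) ^+ 2 = c * x ^+ 2 - 2 * (x * y) + c^-1 * y ^+ 2.
    by field; rewrite gt_eqF.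
  lra.
have : E (fun M => 2 * n%:R * col_dev M j ^+ 2 - 4 * n%:R * (2^-1 * l * col_dev M j ^+ 2 +
    2^-1 / l * gs_sqproj M j ^+ 2) - col_dev M j ^+ 3 - 3 *
    (2^-1 * l2 * col_dev M j ^+ 2 + 2^-1 / l2 * gs_sqproj M j ^+ 4)) <=
  E (fun M => 8 * n%:R ^+ 2 * gs_defect M j ^+ 2).
  apply: le_Ex; [tame_tac|tame_tac|] => M.
  apply: le_trans (sqr_gs_defect_ge M j).
  have := gs_sqproj_ge0 M j; move: (col_dev M j) (gs_sqproj M j) => A s s0.
  have := amgm l A s l0; have := amgm l2 A (s ^+ 2) l20; rewrite -(exprM s 2 2).
  have s3 : 0 <= s ^+ 3 by rewrite exprn_ge0.
  have A2s : 0 <= A ^+ 2 * s by rewrite mulr_ge0// sqr_ge0.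
  have s2 := sqr_ge0 s.
  move=> h2 h1.
  (* The terms [2 n s^2], [3 A^2 s] and [s^3] are nonnegative and are discarded. *)
  have -> : 2 * n%:R * (A - s) ^+ 2 - (A - s) ^+ 3 = 2 * n%:R * A ^+ 2 - 4 * n%:R * (A * s)
    + 2 * n%:R * s ^+ 2 - A ^+ 3 + 3 * (A ^+ 2 * s) - 3 * (A * s ^+ 2) + s ^+ 3 by ring.
  have := ler_wpM2l (ltW n0) h1; have := mulr_ge0 (ltW n0) s2; lra.
rewrite !(ExB, ExD, ExZ); try by tame_tac.
rewrite (Ex_col_dev2 nuN) (Ex_col_dev3 nuN).
have hs2 := Ex_sqproj2 nuN j; have hs4 := Ex_sqproj4 nuN j.
move: (E (fun M => gs_defect M j ^+ 2)) (E (fun M => gs_sqproj M j ^+ 2))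
  (E (fun M => gs_sqproj M j ^+ 4)) hs2 hs4 => d y z hy hz h.
have hy' : y <= 3 * k ^+ 2.
  by apply: le_trans hy _; rewrite ler_wpM2l// ler_sqr.
have hz' : z <= 105 * k ^+ 4.
  apply: le_trans hz _; rewrite ler_wpM2l// !(exprM _ 2 2).
  by rewrite !ler_sqr ?sqr_ge0.
have m1 : 1 <= m.
  by rewrite -[1]sqrtr1 ler_wsqrtr// ler1n -(ltr0n R).
have k0 : 0 < k := lt_le_trans ltr01 k1.
have km0 : 0 < k * m ^+ 3 by rewrite mulr_gt0// exprn_gt0.
have F1 : 2^-1 * l * (2 * n%:R) = k * m.
  by rewrite -mn /l; field; rewrite gt_eqF.
have F2 : 2^-1 / l * y <= 3 / 2 * k * m.
  have -> : 2^-1 / l = m / (2 * k) by rewrite /l; field; rewrite !gt_eqF.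
  have -> : 3 / 2 * k * m = m / (2 * k) * (3 * k ^+ 2) by field; rewrite gt_eqF.
  by rewrite ler_wpM2l// divr_ge0 ?mulr_ge0 ?ltW.
have F3 : 2^-1 * l2 * (2 * n%:R) = k ^+ 2 * m.
  by rewrite -mn /l2; field; rewrite gt_eqF.
have F4 : 2^-1 / l2 * z <= 105 / 2 * k ^+ 2 * m.
  have -> : 2^-1 / l2 = m / (2 * k ^+ 2) by rewrite /l2; field; rewrite !gt_eqF.
  have -> : 105 / 2 * k ^+ 2 * m = m / (2 * k ^+ 2) * (105 * k ^+ 4).
    by field; rewrite gt_eqF.
  by rewrite ler_wpM2l// divr_ge0 ?mulr_ge0 ?exprn_ge0 ?ltW.
have F7 : k * m ^+ 3 <= B * k * m ^+ 3 by rewrite -mulrA ler_peMl// ltW.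
have F6 : m ^+ 2 <= k * m ^+ 3.
  by rewrite exprS mulrA ler_peMl ?sqr_ge0// mulr_ege1.
have F5 : k ^+ 2 * m <= B * k * m ^+ 3.
  apply: (@le_trans _ _ (B * m ^+ 3)).
    rewrite (exprSr m 2) mulrA; apply: ler_wpM2r; first exact: ltW.
    by rewrite mn.
  apply: ler_wpM2r; first by apply: exprn_ge0; exact: ltW.
  by apply: ler_peMr => //; exact: le_trans B1.
have m40 : 0 < 8 * m ^+ 4 by rewrite mulr_gt0// exprn_gt0.
rewrite -(ler_pM2l m40).
(* In units of [B k m^3] the errors add up to at most [4 + 6 + 8 + 3 (1 + 105/2) = 178.5], below
   [192 = 8 * 24]. *)
have -> : 8 * m ^+ 4 * (2^-1 - 24 * B * k / m) = 4 * m ^+ 4 - 192 * (B * k * m ^+ 3).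
  by field; rewrite gt_eqF.
have G := ler_wpM2l (sqr_ge0 m) F2.
move: h; rewrite F1 F3 -mn => h.
have e4 : 2 * m ^+ 2 * (2 * m ^+ 2) = 4 * m ^+ 4 by ring.
have e5 : 8 * (m ^+ 2) ^+ 2 * d = 8 * m ^+ 4 * d by ring.
have e6 : m ^+ 2 * (3 / 2 * k * m) = 3 / 2 * (k * m ^+ 3) by ring.
have e7 : 4 * m ^+ 2 * (k * m + 2^-1 / l * y) = 4 * (k * m ^+ 3) + 4 * (m ^+ 2 * (2^-1 / l * y)).
  by ring.
move: h; rewrite e4 e5 e7 => h.
move: G; rewrite e6 => G.
by lra.
Qed.

Lemma rank_gap_defect4 (M : 'M[R]_n) j :
  n%:R ^+ 2 * (1 - dotv (gs M j) (gs M j)) <= gs_defect M j ^+ 4.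
Proof.
rewrite gs_normalized; have [h|h] := eqVneq (normv (gs_rest M j)) 0; last first.
  by rewrite subrr mulr0 exprn_even_ge0.
rewrite subr0 mulr1 /gs_defect h subr0 (exprM _ 2 2) sqr_sqrtr//.
Qed.

(** If [w_j = 0] the defect is [sqrt n], so its square is its fourth power over [n]. Dropping the
    factor [|gamma_j|^2] in [sqr_gs_err] thus costs [O(1/n)] in mean. *)
Lemma defect2_rank_gap (M : 'M[R]_n) j :
  n%:R * (gs_defect M j ^+ 2 * (1 - dotv (gs M j) (gs M j))) <= gs_defect M j ^+ 4.
Proof.
rewrite gs_normalized; have [h|h] := eqVneq (normv (gs_rest M j)) 0; last first.
  by rewrite subrr !mulr0 exprn_even_ge0.
by rewrite subr0 mulr1 /gs_defect h subr0 (exprM _ 2 2) sqr_sqrtr// expr2.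
Qed.

Lemma tame_gs_sqnorm j : tame nu (fun M => dotv (gs M j) (gs M j)).
Proof. by apply: tame_dotv; exact: tamev_gs. Qed.

Lemma gs_rank_defect_le (B : R) j : 1 <= B -> j%:R ^+ 2 <= B * n%:R ->
  gs_rank_defect nu j <= defect4_bound B / n%:R ^+ 2.
Proof.
move=> B1 jB; have n0 := natr_ord_gt0 j; have tD := tame_gs_defect nuN j.
have tg := tame_gs_sqnorm j.
rewrite ler_pdivlMr ?exprn_gt0// mulrC.
apply: le_trans (Ex_gs_defect4 B1 jB); rewrite /gs_rank_defect -ExZ; last by tame_tac.
by apply: le_Ex; [tame_tac|tame_tac|move=> M; exact: rank_gap_defect4].
Qed.

(** Only degenerate earlier vectors can make the mean fall short of [j]. *)
Lemma Ex_sqproj1_ge (B : R) j : 1 <= B -> j%:R ^+ 2 <= B * n%:R ->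
  j%:R * (1 - defect4_bound B / n%:R ^+ 2) <= E (fun M => gs_sqproj M j).
Proof.
move=> B1 jB; rewrite /gs_sqproj Ex_sum; last first.
  move=> i _; apply: tameX; apply: tame_dotv; first exact: tamev_col.
  by apply: tamev_gs => //; exact: ltn_trans (ltn_ord j).
rewrite mulr_natl -[in leLHS](card_ord j) -sumr_const; apply: ler_sum => i _.
have hi : (i < n)%N by exact: ltn_trans (ltn_ord j).
rewrite (Ex_sq_coef nuN (ltn_ord i) hi) lerD2l lerN2; apply: gs_rank_defect_le => //.
by apply: le_trans jB; rewrite ler_sqr//= ler_nat ltnW.
Qed.

Lemma tame_sqr_gs_err j : tame nu (fun M => dotv (gs_err M j) (gs_err M j)).
Proof. by apply: tame_dotv; exact: tamev_gs_err. Qed.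

Lemma sqr_gs_err_le (M : 'M[R]_n) j :
  dotv (gs_err M j) (gs_err M j) <= gs_defect M j ^+ 2 + gs_sqproj M j.
Proof.
rewrite sqr_gs_err lerD2r gs_normalized.
by case: (_ != _); rewrite ?mulr1// mulr0 sqr_ge0.
Qed.

Lemma Ex_sqr_gs_err_le (B : R) j : 1 <= B -> j%:R ^+ 2 <= B * n%:R ->
  E (fun M => dotv (gs_err M j) (gs_err M j)) <= 10 * B + j%:R.
Proof.
move=> B1 jB; have tD := tame_gs_defect nuN j; have ts := tame_gs_sqproj nuN j.
have te := tame_sqr_gs_err j.
apply: (@le_trans _ _ (E (fun M => gs_defect M j ^+ 2 + gs_sqproj M j))).
  by apply: le_Ex; [tame_tac|tame_tac|move=> M; exact: sqr_gs_err_le].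
by rewrite ExD; [|tame_tac..]; apply: lerD; [exact: Ex_gs_defect2|exact: Ex_sqproj1].
Qed.

Lemma Ex_sqr_gs_err2_le (B : R) j : 1 <= B -> j%:R ^+ 2 <= B * n%:R ->
  E (fun M => dotv (gs_err M j) (gs_err M j) ^+ 2) <= (2 * defect4_bound B + 6) * j.+1%:R ^+ 2.
Proof.
move=> B1 jB; have tD := tame_gs_defect nuN j; have ts := tame_gs_sqproj nuN j.
have te := tame_sqr_gs_err j.
apply: (@le_trans _ _ (E (fun M => 2 * gs_defect M j ^+ 4 + 2 * gs_sqproj M j ^+ 2))).
  apply: le_Ex; [tame_tac|tame_tac|move=> M].
  apply: le_trans (ler_sqr (dotvv_ge0 _) (sqr_gs_err_le M j)) _.
  by apply: le_trans (sqrD_le _ _) _; rewrite -exprM.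
rewrite ExD ?ExZ; [|tame_tac..].
have := Ex_gs_defect4 B1 jB; have := Ex_sqproj2 nuN j.
have := defect4_bound_ge0 B; have : j%:R ^+ 2 <= j.+1%:R ^+ 2 :> R by rewrite ler_sqr// ler_nat.
have : 1 <= j.+1%:R ^+ 2 :> R by rewrite expr_ge1// ler1n.
move: (defect4_bound B) (j%:R ^+ 2) (j.+1%:R ^+ 2) => b x y; nra.
Qed.

(** One [defect4_bound] pays for the factor [|gamma_j|^2] of the squared defect, the other for
    degenerate vectors in the mean of [gs_sqproj]; both errors fit into the order [(j + 1) / sqrt n]
    of [Ex_gs_defect2_ge]. *)
Lemma Ex_sqr_gs_err_ge (B : R) j : 1 <= B -> j.+1%:R ^+ 2 <= B * n%:R ->
  2^-1 + j%:R - (24 * B + 2 * defect4_bound B) * (j.+1%:R / Num.sqrt n%:R) <=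
  E (fun M => dotv (gs_err M j) (gs_err M j)).
Proof.
move=> B1 jB; have n0 := natr_ord_gt0 j.
have tD := tame_gs_defect nuN j; have ts := tame_gs_sqproj nuN j.
have te := tame_sqr_gs_err j; have tg := tame_gs_sqnorm j.
have jB' : j%:R ^+ 2 <= B * n%:R by apply: le_trans jB; rewrite ler_sqr// ler_nat.
have : E (fun M => gs_defect M j ^+ 2 - n%:R^-1 * gs_defect M j ^+ 4 + gs_sqproj M j) <=
    E (fun M => dotv (gs_err M j) (gs_err M j)).
  apply: le_Ex; [tame_tac|tame_tac|move=> M].
  rewrite sqr_gs_err lerD2r; have := defect2_rank_gap M j.
  rewrite -ler_pdivlMl// => h; have e := @mulrBr R (gs_defect M j ^+ 2) 1 (dotv (gs M j) (gs M j)).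
  move: h; rewrite e mulr1; lra.
apply: le_trans; rewrite ExD ?ExB ?ExZ; try by tame_tac.
have h1 := Ex_gs_defect2_ge B1 jB; have h2 := Ex_gs_defect4 B1 jB'.
have h3 := Ex_sqproj1_ge B1 jB'.
set m : R := Num.sqrt n%:R in h1 *.
have m0 : 0 < m by rewrite sqrtr_gt0.
have mn : m ^+ 2 = n%:R by rewrite sqr_sqrtr// ltW.
have m1 : 1 <= m by rewrite -[1]sqrtr1 ler_wsqrtr// ler1n -(ltr0n R).
have k1 : 1 <= j.+1%:R :> R by rewrite ler1n.
have nk : n%:R^-1 <= j.+1%:R / m.
  rewrite -[n%:R^-1]div1r; apply: ler_pM; [exact: ler01|by rewrite invr_ge0 ltW|exact: k1|].
  by rewrite lef_pV2 ?posrE// -mn expr2 ler_peMl// ltW.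
have nk2 : j%:R / n%:R ^+ 2 <= j.+1%:R / m.
  apply: ler_pM; [exact: ler0n|by rewrite invr_ge0 exprn_ge0// ltW|by rewrite ler_nat|].
  rewrite lef_pV2 ?posrE ?exprn_gt0// -mn -exprM (exprS m 3) ler_peMr//; first exact: ltW.
  by rewrite expr_ge1// ltW.
have g2 : n%:R^-1 * E (fun M => gs_defect M j ^+ 4) <= defect4_bound B * (j.+1%:R / m).
  rewrite [leRHS]mulrC; apply: ler_pM; [by rewrite invr_ge0 ltW| |exact: nk|exact: h2].
  by apply: Ex_ge0 => M; rewrite exprn_even_ge0.
have g3 : j%:R * (defect4_bound B / n%:R ^+ 2) <= defect4_bound B * (j.+1%:R / m).
  have -> : j%:R * (defect4_bound B / n%:R ^+ 2) = defect4_bound B * (j%:R / n%:R ^+ 2) by rewrite mulrCA.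
  by rewrite ler_wpM2l// defect4_bound_ge0.
move: h3; rewrite mulrBr mulr1 => h3.
move: h1; rewrite -(mulrA (24 * B)) => h1.
rewrite mulrDl -(mulrA 2); lra.
Qed.

End ErrorMoments.

(** * Errors of the entries *)

Section RowMoments.
Variables (R : realType) (n : nat).
Local Notation mxT := (mxT R n).
Variable nu : probability mxT R.
Hypothesis nuN : std_normal_mx nu.
Local Notation E := (Ex nu).
Implicit Types (i j a b : 'I_n).

Lemma gs_mx_rperm_entry s (M : 'M[R]_n) j a :
  gs (mx_rperm s M) j a 0 = gs M j (s a) 0.
Proof. by rewrite /mx_rperm gs_row_perm// mxE. Qed.

(** The defect is invariant under row permutations, so exchangeability puts the sum over the rows
    inside the mean, and the sum of the fourth powers of the entries is at most
    [|gamma_j|^2 <= 1]. *)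
Lemma Ex_defect_entry4 (B : R) j a : 1 <= B -> j%:R ^+ 2 <= B * n%:R ->
  n%:R * E (fun M => gs_defect M j ^+ 4 * gs M j a 0 ^+ 4) <= defect4_bound B.
Proof.
move=> B1 jB; have tD := tame_gs_defect nuN j.
have tg b : tame nu (fun M => gs M j b 0) by exact: tamev_gs.
rewrite (Ex_exchangeable_sum nuN (f := fun M a => gs_defect M j ^+ 4 * gs M j a 0 ^+ 4)).
- apply: le_trans (Ex_gs_defect4 nuN B1 jB); apply: le_Ex => [||M].
  + by apply: tame_sum => b _; tame_tac.
  + by tame_tac.
  + rewrite -mulr_sumr ler_piMr ?exprn_even_ge0//.
    apply: (@le_trans _ _ (dotv (gs M j) (gs M j))); last first.
      by rewrite gs_normalized; case: (_ != _).
    apply: ler_sum => b _; rewrite -expr2 (exprM _ 2 2).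
    have := gs_entry_le1 M j b; rewrite -(@expr_le1 _ 2)// real_normK ?num_real//.
    by move=> h; rewrite expr2 ler_piMr// sqr_ge0.
- by move=> b; tame_tac.
- by move=> s M b; rewrite gs_mx_rperm_entry /mx_rperm gs_defect_row_perm.
Qed.

(** Given the past, the entry is normal with variance [|P e_a|^2], where [P] is the projection on
    the earlier vectors and [e_a] a basis vector; 3 is the fourth normal moment. *)
Lemma Ex_gs_proj_entry4 j a :
  E (fun M => gs_proj M j (col j M) a 0 ^+ 4) =
  3 * E (fun M => (\sum_(i < j) gs M i a 0 ^+ 2) ^+ 2).
Proof.
have tp : tamev nu (fun M : 'M[R]_n => gs_proj M j (delta_mx a 0)).
  by apply: tamev_gs_proj => // b; exact: tame_cst.
have ip b c : indep_entry (fun M : 'M[R]_n => gs_proj M j (delta_mx a 0) b 0) c j.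
  move=> M x; congr (fun_of_matrix _ b 0); apply: eq_gs_proj => i ij.
  apply: (@eq_gs _ _ _ _ j) => //; last exact: ltn_trans (ltn_ord j).
  move=> l lj; apply/matrixP => d e; rewrite !mxE/=.
  by case: eqP => //= _; case: eqP => // lj'; rewrite lj' ltnn in lj.
have := Ex_col_dotv_pow nuN (H := fun=> 1) 4 tp ip (tame_cst _ _) (fun _ _ _ => erefl).
rewrite normal_moment4; under eq_Ex do rewrite mul1r; under [in RHS]eq_Ex do rewrite mul1r.
move=> h; transitivity (E (fun M => dotv (col j M) (gs_proj M j (delta_mx a 0)) ^+ 4)).
  by apply: eq_Ex => M; rewrite gs_proj_entry.
rewrite h; congr (_ * _); apply: eq_Ex => M; congr (_ ^+ 2).
rewrite (sqr_gs_proj M (delta_mx a 0) (ltnW (ltn_ord j))).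
by apply: eq_bigr => i _; rewrite dotv_delta.
Qed.

Lemma tame_gs_row j a : tame nu (fun M => \sum_(i < j) gs M i a 0 ^+ 2).
Proof.
apply: tame_sum => i _; apply: tameX; apply: tamev_gs => //.
exact: ltn_trans (ltn_ord j).
Qed.

(** First pass: by Bessel's inequality the variance is at most 1. This crude bound controls the
    entries of [gs_rest], hence those of [gs], which in turn give the bound of order [1/n] in
    [Ex_gs_proj_entry4_le]. *)
Lemma Ex_gs_proj_entry4_le3 j a : E (fun M => gs_proj M j (col j M) a 0 ^+ 4) <= 3.
Proof.
rewrite Ex_gs_proj_entry4 ler_piMr// -[leRHS](Ex_cst nu); apply: le_Ex => [||M].
- by apply: tameX; exact: tame_gs_row.
- exact: tame_cst.
- apply: le_trans (ler_sqr _ (gs_row_le1 M a (ltnW (ltn_ord j)))) _.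
    by apply: sumr_ge0 => i _; exact: sqr_ge0.
  by rewrite expr1n.
Qed.

Lemma Ex_entry4 a j : E (fun M => M a j ^+ 4) = 3.
Proof.
have := @Ex_mul_entry R n nu nuN (fun=> 1) a j 4 (tame_cst _ _) (fun _ _ => erefl).
by rewrite normal_moment4 Ex_cst mulr1 => <-; apply: eq_Ex => M; rewrite mul1r.
Qed.

Lemma Ex_gs_rest_entry4 j a : E (fun M => gs_rest M j a 0 ^+ 4) <= 48.
Proof.
have te : tame nu (fun M => M a j) by exact: tame_entry.
have tp : tame nu (fun M => gs_proj M j (col j M) a 0).
  by apply: tamev_gs_proj => //; exact: tamev_col.
have tr : tame nu (fun M => gs_rest M j a 0) by exact: tamev_gs_rest.
apply: (@le_trans _ _ (E (fun M => 8 * M a j ^+ 4 + 8 * gs_proj M j (col j M) a 0 ^+ 4))).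
  by apply: le_Ex; [tame_tac|tame_tac|move=> M; rewrite !mxE; exact: exprB4_le].
rewrite ExD ?ExZ; [|tame_tac..].
rewrite Ex_entry4; have := Ex_gs_proj_entry4_le3 j a; lra.
Qed.

(** [384 = 8 * 48], where [48 = 8 * 3 + 8 * 3] bounds the residual entry. *)
Lemma Ex_gs_entry4 (B : R) j a : 1 <= B -> j%:R ^+ 2 <= B * n%:R ->
  n%:R ^+ 2 * E (fun M => gs M j a 0 ^+ 4) <= (384 + 8 * defect4_bound B).
Proof.
move=> B1 jB; have n0 := natr_ord_gt0 R j.
have tD := tame_gs_defect nuN j.
have tg : tame nu (fun M => gs M j a 0) by exact: tamev_gs.
have tr : tame nu (fun M => gs_rest M j a 0) by exact: tamev_gs_rest.
rewrite -ExZ; last by tame_tac.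
apply: (@le_trans _ _ (E (fun M => 8 * gs_rest M j a 0 ^+ 4 +
    8 * (gs_defect M j ^+ 4 * gs M j a 0 ^+ 4)))).
  apply: le_Ex; [tame_tac|tame_tac|move=> M].
  have : (Num.sqrt n%:R *: gs M j) a 0 = (gs_rest M j + gs_defect M j *: gs M j) a 0.
    by rewrite sqrtn_gsE.
  rewrite mxE [in RHS]mxE [in X in _ + X]mxE => e.
  have -> : n%:R ^+ 2 * gs M j a 0 ^+ 4 = (Num.sqrt n%:R * gs M j a 0) ^+ 4.
    by rewrite exprMn (exprM (Num.sqrt _) 2 2) sqr_sqrtr// ltW.
  by rewrite e -exprMn; exact: exprD4_le.
rewrite ExD ?ExZ; [|tame_tac..].
have h1 := Ex_gs_rest_entry4 j a; have h2 := Ex_defect_entry4 a B1 jB.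
have h3 : E (fun M => gs_defect M j ^+ 4 * gs M j a 0 ^+ 4) <= defect4_bound B.
  apply: le_trans h2; rewrite ler_peMl ?ler1n -?(ltr0n R)//.
  by apply: Ex_ge0 => M; rewrite mulr_ge0// exprn_even_ge0.
by lra.
Qed.

(** Second pass: by Cauchy-Schwarz the squared variance is at most [j] times a sum of [j] fourth
    powers of entries of [gs], of mean [O(j^2 / n^2)] by [Ex_gs_entry4]; then [j^2 <= B n]. *)
Lemma Ex_gs_proj_entry4_le (B : R) j a : 1 <= B -> j%:R ^+ 2 <= B * n%:R ->
  n%:R * E (fun M => gs_proj M j (col j M) a 0 ^+ 4) <= 3 * B * (384 + 8 * defect4_bound B).
Proof.
move=> B1 jB; have n0 := natr_ord_gt0 R j.
have tg (i : 'I_j) : tame nu (fun M => gs M i a 0).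
  by apply: tamev_gs => //; exact: ltn_trans (ltn_ord j).
rewrite Ex_gs_proj_entry4.
have h : E (fun M => (\sum_(i < j) gs M i a 0 ^+ 2) ^+ 2) <=
    j%:R * \sum_(i < j) E (fun M => gs M i a 0 ^+ 4).
  rewrite -Ex_sum; last by move=> i _; apply: tameX.
  rewrite -ExZ; last by apply: tame_sum => i _; apply: tameX.
  apply: le_Ex => [||M].
  - by apply: tameX; exact: tame_gs_row.
  - by apply: tameZ; apply: tame_sum => i _; apply: tameX.
  - apply: le_trans (sqr_sum_ord_le _) _.
    by under eq_bigr do rewrite -exprM.
have h2 : n%:R ^+ 2 * \sum_(i < j) E (fun M => gs M i a 0 ^+ 4) <= j%:R * ((384 + 8 * defect4_bound B)).
  rewrite mulr_sumr mulr_natl -[in leRHS](card_ord j) -sumr_const.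
  apply: ler_sum => i _; have hi : (i < n)%N by exact: ltn_trans (ltn_ord j).
  apply: (@Ex_gs_entry4 B (Ordinal hi)) => //.
  by apply: le_trans jB; rewrite ler_sqr//= ler_nat ltnW.
rewrite -(ler_pM2l n0).
move: h h2; move: (E _) (\sum_(i < j) _) => x y h h2.
apply: (@le_trans _ _ (3 * (j%:R * (j%:R * ((384 + 8 * defect4_bound B)))))).
  have := ler_wpM2l (ler0n R j) h2.
  have := ler_wpM2l (sqr_ge0 (n%:R : R)) h; lra.
have k0 : 0 <= 384 + 8 * defect4_bound B by have := defect4_bound_ge0 B; lra.
have := ler_wpM2r k0 jB; move: (384 + _) => k; rewrite expr2 => h3.
have -> : n%:R * (3 * B * k) = 3 * (B * n%:R * k) by ring.
by rewrite ler_wpM2l// mulrA.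
Qed.

(** 8 times the bounds of [Ex_defect_entry4] and [Ex_gs_proj_entry4_le], the 8 coming from
    [exprB4_le]. *)
Definition err4_bound (B : R) := 8 * defect4_bound B + 24 * B * (384 + 8 * defect4_bound B).

Lemma err4_bound_ge0 B : 1 <= B -> 0 <= err4_bound B.
Proof.
move=> B1; have b0 := defect4_bound_ge0 B; have B0 := le_trans ler01 B1.
by rewrite /err4_bound; have := mulr_ge0 B0 b0; lra.
Qed.

Lemma Ex_gs_err_entry4 (B : R) j a : 1 <= B -> j%:R ^+ 2 <= B * n%:R ->
  n%:R * E (fun M => gs_err M j a 0 ^+ 4) <= err4_bound B.
Proof.
move=> B1 jB; have n0 := natr_ord_gt0 R j.
have tD := tame_gs_defect nuN j.
have tg : tame nu (fun M => gs M j a 0) by exact: tamev_gs.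
have te : tame nu (fun M => gs_err M j a 0) by exact: tamev_gs_err.
have tp : tame nu (fun M => gs_proj M j (col j M) a 0).
  by apply: tamev_gs_proj => //; exact: tamev_col.
have : E (fun M => gs_err M j a 0 ^+ 4) <= E (fun M =>
    8 * (gs_defect M j ^+ 4 * gs M j a 0 ^+ 4) + 8 * gs_proj M j (col j M) a 0 ^+ 4).
  apply: le_Ex; [tame_tac|tame_tac|move=> M].
  by rewrite gs_errE mxE [in X in X + _]mxE [in X in _ + X]mxE -exprMn; exact: exprB4_le.
rewrite ExD ?ExZ; [|tame_tac..].
move=> /(ler_wpM2l (ltW n0)).
have := Ex_defect_entry4 a B1 jB; have := Ex_gs_proj_entry4_le a B1 jB.
by rewrite /err4_bound; lra.
Qed.

End RowMoments.

(** * Moments of the squared error of a block *)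

Section BlockError.
Variables (R : realType) (n : nat).
Local Notation mxT := (mxT R n).
Variable nu : probability mxT R.
Hypothesis nuN : std_normal_mx nu.
Local Notation E := (Ex nu).
Implicit Types (i j a b : 'I_n).
Variables p q : nat.
Hypotheses (pn : (p <= n)%N) (qn : (q <= n)%N).
Variable B : R.
Hypotheses (B1 : 1 <= B) (qB : q%:R ^+ 2 <= B * n%:R).
Hypothesis n1 : (1 < n)%N.

Definition row_err (M : 'M[R]_n) a := \sum_(j < n | (j < q)%N) gs_err M j a 0 ^+ 2.
Definition block_err (M : 'M[R]_n) := \sum_(a < n | (a < p)%N) row_err M a.

Lemma tame_row_err a : tame nu (fun M => row_err M a).
Proof. by apply: tame_sum => j _; apply: tameX; exact: tamev_gs_err. Qed.

Lemma tame_block_err : tame nu block_err.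
Proof. by apply: tame_sum => a _; exact: tame_row_err. Qed.

Lemma row_err_rperm s (M : 'M[R]_n) a : row_err (mx_rperm s M) a = row_err M (s a).
Proof. by apply: eq_bigr => j _; rewrite /mx_rperm gs_err_row_perm mxE. Qed.

Lemma sum_ord_lt_const (k : nat) (c : R) : (k <= n)%N -> \sum_(a < n | (a < k)%N) c = k%:R * c.
Proof. by move=> kn; rewrite (big_ord_narrow kn) sumr_const card_ord mulr_natl. Qed.

Lemma sum_row_err (M : 'M[R]_n) : \sum_a row_err M a =
  \sum_(j < n | (j < q)%N) dotv (gs_err M j) (gs_err M j).
Proof.
rewrite exchange_big/=; apply: eq_bigr => j _; apply: eq_bigr => a _.
by rewrite expr2.
Qed.

Lemma Ex_block_errE : n%:R * E block_err =
  p%:R * \sum_(j < n | (j < q)%N) E (fun M => dotv (gs_err M j) (gs_err M j)).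
Proof.
have n0 : (0 < n)%N by apply: ltn_trans n1.
pose a0 := Ordinal n0.
rewrite Ex_sum; last by move=> a _; exact: tame_row_err.
rewrite (eq_bigr (fun=> E (fun M => row_err M a0))); last first.
  by move=> a _; apply: (Ex_exchangeable nuN tame_row_err row_err_rperm).
rewrite sum_ord_lt_const// mulrCA (Ex_exchangeable_sum nuN tame_row_err row_err_rperm).
congr (_ * _); under eq_Ex do rewrite sum_row_err.
by rewrite Ex_sum// => j _; exact: tame_sqr_gs_err.
Qed.

Let jB (j : 'I_n) : (j < q)%N -> j.+1%:R ^+ 2 <= B * n%:R.
Proof. by move=> jq; apply: le_trans qB; rewrite ler_sqr// ler_nat. Qed.

Let jB' (j : 'I_n) : (j < q)%N -> j%:R ^+ 2 <= B * n%:R.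
Proof. by move=> jq; apply: le_trans (jB jq); rewrite ler_sqr// ler_nat. Qed.

Let q2 : q%:R <= q%:R ^+ 2 :> R.
Proof. by rewrite -natrX ler_nat; case: q => // k; rewrite expnS leq_pmulr. Qed.

Let n0 : 0 < n%:R :> R. Proof. by rewrite ltr0n ltnW. Qed.

(** [11 = 10 + 1]: the sum of [10 B + q] over [q] columns is at most [11 B q^2]. *)
Lemma Ex_block_err_le : E block_err <= 11 * B * (p * q ^ 2)%:R / n%:R.
Proof.
rewrite ler_pdivlMr// mulrC Ex_block_errE.
rewrite natrM [leRHS]mulrCA ler_wpM2l// natrX.
apply: (@le_trans _ _ (\sum_(j < n | (j < q)%N) (10 * B + q%:R))).
  apply: ler_sum => j jq; apply: le_trans (Ex_sqr_gs_err_le nuN B1 (jB' jq)) _.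
  by rewrite lerD2l ler_nat ltnW.
rewrite sum_ord_lt_const//.
have := q2; have := ler0n R q; move: (q%:R : R) B B1 => x c c1 x0 x2; nra.
Qed.

Lemma Ex_block_err_ge : (p * q ^ 2)%:R / n%:R * (2^-1 - (24 * B + 2 * defect4_bound B) / Num.sqrt n%:R)
  <= E block_err.
Proof.
rewrite -(ler_pM2l n0) Ex_block_errE.
have e (x : R) : n%:R * ((p * q ^ 2)%:R / n%:R * x) = p%:R * (q%:R ^+ 2 * x).
  by rewrite natrM natrX; field; rewrite gt_eqF.
rewrite e ler_wpM2l//.
apply: (@le_trans _ _ (\sum_(j < n | (j < q)%N)
    (2^-1 + j%:R - (24 * B + 2 * defect4_bound B) * (q%:R / Num.sqrt n%:R)))); last first.
  apply: ler_sum => j jq; apply: le_trans (Ex_sqr_gs_err_ge nuN B1 (jB jq)).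
  rewrite lerD2l lerN2; apply: ler_wpM2l.
    have := defect4_bound_ge0 B; move: B1; lra.
  by apply: ler_wpM2r; [rewrite invr_ge0 sqrtr_ge0|rewrite ler_nat].
rewrite sumrB sum_ord_lt_const// (big_ord_narrow qn)/=.
(* Here the 1/2 of the squared defects completes the sum of the [i] to exactly [q^2 / 2]. *)
have -> : \sum_(i < q) (2^-1 + i%:R) = q%:R ^+ 2 / 2 :> R.
  elim: (q) => [|k IH]; first by rewrite big_ord0 expr0n mul0r.
  by rewrite big_ord_recr/= IH -natr1; field.
by move: (24 * B + _) (Num.sqrt _)^-1 => x y; rewrite le_eqVlt; apply/orP; left; apply/eqP; ring.
Qed.

(** Cauchy-Schwarz over the [q] columns; the factor [1/n] comes from the fourth moments of single
    entries. *)
Lemma Ex_row_err2_le a : E (fun M => row_err M a ^+ 2) <= err4_bound B * q%:R ^+ 2 / n%:R.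
Proof.
have t j : tame nu (fun M => gs_err M j a 0 ^+ 4) by apply: tameX; exact: tamev_gs_err.
apply: (@le_trans _ _ (E (fun M => q%:R * \sum_(j < n | (j < q)%N) gs_err M j a 0 ^+ 4))).
  apply: le_Ex => [||M].
  - by apply: tameX; exact: tame_row_err.
  - by apply: tameZ; apply: tame_sum => j _.
  - rewrite /row_err !(big_ord_narrow qn); apply: le_trans (sqr_sum_ord_le _) _.
    by under eq_bigr do rewrite -exprM.
rewrite ExZ; last by apply: tame_sum => j _.
rewrite Ex_sum// ler_pdivlMr// mulrC.
have -> : err4_bound B * q%:R ^+ 2 = q%:R * (q%:R * err4_bound B).
  by rewrite mulrC mulrA expr2.
rewrite mulrCA ler_wpM2l// mulr_sumr -sum_ord_lt_const//.
by apply: ler_sum => j jq; apply: Ex_gs_err_entry4 => //; exact: jB'.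
Qed.

Lemma Ex_sum_row_err2_le : E (fun M => (\sum_a row_err M a) ^+ 2) <= (2 * defect4_bound B + 6) * q%:R ^+ 4.
Proof.
have t j : tame nu (fun M => dotv (gs_err M j) (gs_err M j) ^+ 2).
  by apply: tameX; exact: tame_sqr_gs_err.
apply: (@le_trans _ _ (E (fun M => q%:R *
    \sum_(j < n | (j < q)%N) dotv (gs_err M j) (gs_err M j) ^+ 2))).
  apply: le_Ex => [||M].
  - by apply: tameX; apply: tame_sum => a _; exact: tame_row_err.
  - by apply: tameZ; apply: tame_sum => j _.
  - by rewrite sum_row_err !(big_ord_narrow qn); exact: sqr_sum_ord_le.
rewrite ExZ; last by apply: tame_sum => j _.
rewrite Ex_sum//.
have -> : (2 * defect4_bound B + 6) * q%:R ^+ 4 =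
    q%:R * (q%:R * ((2 * defect4_bound B + 6) * q%:R ^+ 2)).
  by move: (2 * _ + _) => x; ring.
rewrite ler_wpM2l// -sum_ord_lt_const//; apply: ler_sum => j jq.
apply: le_trans (Ex_sqr_gs_err2_le nuN B1 (jB' jq)) _.
apply: ler_wpM2l; first by have := defect4_bound_ge0 B; lra.
by apply: ler_sqr; rewrite ?ler0n ?ler_nat.
Qed.

(** Products of two distinct rows all have the same mean [e], and [n (n - 1) e] is at most the
    second moment of the sum over all rows, which is [O(q^4)]; so [p^2 e] is [O((p q^2 / n)^2)],
    with a factor 2 from [n <= 2 (n - 1)]. On the diagonal the same averaging would only give
    [p q^4 / n], which may be unbounded, so [Ex_row_err2_le] is used there. *)
Lemma Ex_block_err2_le : E (fun M => block_err M ^+ 2) <=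
  err4_bound B * ((p * q ^ 2)%:R / n%:R) + 2 * (2 * defect4_bound B + 6) * ((p * q ^ 2)%:R / n%:R) ^+ 2.
Proof.
have n0' : (0 < n)%N by apply: ltn_trans n1.
pose a0 := Ordinal n0'; pose b0 := Ordinal n1.
have tRR a b : tame nu (fun M => row_err M a * row_err M b).
  by apply: tameM; exact: tame_row_err.
pose e := E (fun M => row_err M a0 * row_err M b0).
have R0 M a : 0 <= row_err M a by apply: sumr_ge0 => j _; exact: sqr_ge0.
have e0 : 0 <= e by apply: Ex_ge0 => M; rewrite mulr_ge0.
have Ee a b : a != b -> E (fun M => row_err M a * row_err M b) = e.
  have Es (s : {perm 'I_n}) c d : E (fun M => row_err M c * row_err M d) =
      E (fun M => row_err M (s c) * row_err M (s d)).
    by rewrite -(Ex_rperm nuN s (tRR c d)); apply: eq_Ex => M; rewrite !row_err_rperm.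
  (* Two transpositions carry [(a, b)] to [(a0, b0)]; the second one fixes [a0]. *)
  move=> ab; rewrite (Es (tperm a a0)) tpermL.
  have : tperm a a0 b != a0 by rewrite -[X in _ != X](tpermL a a0) (inj_eq perm_inj) eq_sym.
  move: (tperm a a0 b) => c ca0; rewrite (Es (tperm c b0)) tpermL tpermD//.
have tS : tame nu (fun M => \sum_a row_err M a) by apply: tame_sum => a _; exact: tame_row_err.
have he : e * n%:R ^+ 2 <= 2 * (2 * defect4_bound B + 6) * q%:R ^+ 4.
  have : n%:R * (n.-1%:R * e) <= E (fun M => (\sum_a row_err M a) ^+ 2).
    apply: (@le_trans _ _ (E (fun M => \sum_a \sum_(b | b != a) row_err M a * row_err M b))).
      rewrite Ex_sum; last by move=> a _; apply: tame_sum => b _.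
      rewrite mulr_natl -[in leLHS](card_ord n) -sumr_const; apply: ler_sum => a _.
      rewrite Ex_sum// (eq_bigr (fun=> e)); last by move=> b ba; rewrite Ee// eq_sym.
      by rewrite sumr_const cardC1 card_ord mulr_natl.
    apply: le_Ex => [||M].
    - by apply: tame_sum => a _; apply: tame_sum => b _.
    - exact: tameX.
    - rewrite expr2 mulr_suml; apply: ler_sum => a _; rewrite mulr_sumr.
      by rewrite [leRHS](bigD1 a)//= lerDr mulr_ge0.
  move=> /le_trans /(_ Ex_sum_row_err2_le) h.
  have : n%:R <= 2 * n.-1%:R :> R.
    rewrite -natrM ler_nat mul2n -addnn; case: (n) n1 => [|[|k]] //= _.
    by rewrite addSn addnS !ltnS leq_addr.
  move=> /(ler_wpM2l e0) /(ler_wpM2l (ltW n0)).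
  by move: (2 * defect4_bound B + 6) h => x; lra.
have -> : (fun M => block_err M ^+ 2) = (fun M : mxT => \sum_(a < n | (a < p)%N)
    \sum_(b < n | (b < p)%N) row_err M a * row_err M b).
  apply/funext => M; rewrite expr2 mulr_suml; apply: eq_bigr => a _.
  by rewrite mulr_sumr.
rewrite Ex_sum; last by move=> a _; apply: tame_sum => b _.
apply: (@le_trans _ _ (\sum_(a < n | (a < p)%N)
   (err4_bound B * q%:R ^+ 2 / n%:R + p%:R * e))).
  apply: ler_sum => a ap; rewrite Ex_sum// (bigD1 a)//= lerD//.
    by under eq_Ex do rewrite -expr2; exact: Ex_row_err2_le.
  rewrite -sum_ord_lt_const// [leRHS](bigD1 a)//= -[leLHS]add0r lerD//.
  by apply: ler_sum => b /andP[_ ba]; rewrite Ee// eq_sym.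
rewrite sum_ord_lt_const// mulrDr lerD//.
  by rewrite natrM natrX; move: (err4_bound B) => x; rewrite le_eqVlt; apply/orP; left; apply/eqP; ring.
have -> : p%:R * (p%:R * e) = p%:R ^+ 2 / n%:R ^+ 2 * (e * n%:R ^+ 2).
  by field; rewrite gt_eqF.
have -> : 2 * (2 * defect4_bound B + 6) * ((p * q ^ 2)%:R / n%:R) ^+ 2 =
   p%:R ^+ 2 / n%:R ^+ 2 * (2 * (2 * defect4_bound B + 6) * q%:R ^+ 4).
  by rewrite natrM natrX; move: (2 * (_ + _)) => x; field; rewrite gt_eqF.
by rewrite ler_wpM2l// divr_ge0// sqr_ge0.
Qed.

End BlockError.

(** * Tail bounds *)

Section TailBounds.
Variables (R : realType) (n : nat).
Local Notation mxT := (mxT R n).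
Variable nu : probability mxT R.
Hypothesis nuN : std_normal_mx nu.
Variables p q : nat.
Hypotheses (pn : (p <= n)%N) (qn : (q <= n)%N).
Variable B : R.
Hypotheses (B1 : 1 <= B) (qB : q%:R ^+ 2 <= B * n%:R).
Hypothesis n1 : (1 < n)%N.
Local Notation E := (Ex nu).
Local Notation r := ((p * q ^ 2)%:R / n%:R : R).

(** The squared form of the event lets the moments of [block_err] apply directly. *)
Definition far_event (eps : R) : set mxT := [set M | eps ^+ 2 <= block_err p q M].

Lemma far_eventE eps : 0 < eps -> far_event eps = [set M | eps <= HS_dist p q M].
Proof.
move=> e0; apply/funext => M; rewrite /far_event /= HS_distE -/(block_err p q M).
have b0 : 0 <= block_err p q M.
  by apply: sumr_ge0 => a _; apply: sumr_ge0 => j _; exact: sqr_ge0.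
rewrite -[X in _ <= X](sqr_sqrtr b0); congr is_true.
by apply: ler_pXn2r; rewrite ?nnegrE ?sqrtr_ge0//; exact: ltW.
Qed.

Lemma measurable_far_event eps : measurable (far_event eps).
Proof.
have [m _] := tame_block_err nuN p q.
have := m measurableT `[eps ^+ 2, +oo[%classic (measurable_itv _).
rewrite setTI; congr measurable; apply/funext => M /=.
by rewrite in_itv/= andbT.
Qed.

Lemma far_event_le eps : 0 < eps ->
  fine (nu (far_event eps)) <= 11 * B / eps ^+ 2 * r.
Proof.
move=> e0; have mA := measurable_far_event eps.
rewrite mulrAC ler_pdivlMr ?exprn_gt0// [leRHS]mulrA.
apply: le_trans (Ex_block_err_le nuN pn qn B1 qB n1).
rewrite mulrC -(Ex_indic nu mA) -ExZ; last exact: tame_indic.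
apply: le_Ex => [||M].
- by apply: tameZ; exact: tame_indic.
- exact: tame_block_err.
- rewrite indicE; case: (boolP (M \in far_event eps)) => [|_].
    by rewrite mulr1 => /set_mem.
  rewrite mulr0; apply: sumr_ge0 => a _; apply: sumr_ge0 => j _; exact: sqr_ge0.
Qed.

Lemma far_event_ge eps L : 0 < L ->
  r * (2^-1 - (24 * B + 2 * defect4_bound B) / Num.sqrt n%:R) <=
  eps ^+ 2 + (err4_bound B * r + 2 * (2 * defect4_bound B + 6) * r ^+ 2) / (2 * L) +
  L / 2 * fine (nu (far_event eps)).
Proof.
move=> L0; have mA := measurable_far_event eps.
apply: le_trans (Ex_block_err_ge nuN pn qn B1 qB n1) _.
have tb := tame_block_err nuN p q.
have tA : tame nu (\1_(far_event eps)) by exact: tame_indic.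
have : E (block_err p q) <= E (fun M => eps ^+ 2 + (2 * L)^-1 * block_err p q M ^+ 2 +
    L / 2 * \1_(far_event eps) M).
  apply: le_Ex; [tame_tac|tame_tac|move=> M].
  rewrite indicE; case: (boolP (M \in far_event eps)) => [_|].
    rewrite mulr1; move: (block_err p q M) => b; rewrite -addrA -[leLHS]add0r.
    apply: lerD; first exact: sqr_ge0.
    rewrite -subr_ge0; have -> : (2 * L)^-1 * b ^+ 2 + L / 2 - b = (b - L) ^+ 2 / (2 * L).
      by field; rewrite gt_eqF.
    by rewrite divr_ge0 ?sqr_ge0// mulr_ge0// ltW.
  rewrite notin_setE /far_event/= mulr0 addr0 => /negP; rewrite -ltNge => /ltW h.
  apply: (le_trans h); rewrite lerDl mulr_ge0 ?sqr_ge0// invr_ge0 mulr_ge0//.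
  exact: ltW.
move=> /le_trans; apply; rewrite !(ExD, ExZ, Ex_cst); [|tame_tac..].
rewrite Ex_indic// lerD2r lerD2l mulrC ler_wpM2r//.
  by rewrite invr_ge0 mulr_ge0// ltW.
exact: Ex_block_err2_le.
Qed.

End TailBounds.

(** * Law of the given random matrix *)

Section Law.
Context d (T : measurableType d) (R : realType) (P : probability T R) (n : nat).
Variable y : 'I_n -> 'I_n -> {RV P >-> R}.
Hypothesis iidy : iid_std_normal_matrix y.

Lemma measurable_Ymat : measurable_fun setT (Ymat y : T -> mxT R n).
Proof.
apply: measurable_fun_mx => i j; under eq_fun do rewrite mxE.
exact: measurable_funP.
Qed.

Lemma std_normal_Ymat : exists2 nu : probability (mxT R n) R, std_normal_mx nu &
  forall A, nu A = P (Ymat y @^-1` A).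
Proof.
pose phi : {mfun T >-> mxT R n} :=
  HB.pack (Ymat y : T -> mxT R n) (isMeasurableFun.Build _ _ _ _ _ measurable_Ymat).
exists (distribution P phi) => // B mB.
case: iidy => yN yI.
transitivity (P [set t | forall i j, B i j (y i j t)]).
  congr (P _); apply/funext => t; apply/propext.
  by split=> h i j; have := h i j; rewrite /= mxE.
rewrite yI//; apply: eq_bigr => i _; apply: eq_bigr => j _; exact: yN.
Qed.

End Law.

(** * Passage to the limit *)

Lemma limn_einf_gt0 (R : realType) (u : nat -> \bar R) (c : R) : 0 < c ->
  (\forall n \near \oo, (c%:E <= u n)%E) -> (0 < limn_einf u)%E.
Proof.
move=> c0 [N _ Nu]; apply: (@lt_le_trans _ _ c%:E); first by rewrite lte_fin.
rewrite limn_einf_lim; apply: lime_ge; first exact: is_cvg_einfs.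
exists N => // k /= Nk; apply: le_ereal_inf_tmp => _ [l /= kl <-].
by apply: Nu => /=; exact: leq_trans kl.
Qed.

Lemma cvg_sqrt_natV (R : realType) : (fun n : nat => (Num.sqrt (n%:R : R))^-1) @ \oo --> (0 : R).
Proof.
have -> : (fun n => (Num.sqrt n%:R)^-1) = (fun n : nat => Num.sqrt (n%:R^-1 : R)).
  by apply/funext => n; rewrite sqrtrV.
rewrite -[X in _ --> X](@sqrtr0 R).
apply: (@cvg_comp _ _ _ (fun n : nat => n%:R^-1 : R) (@Num.sqrt R) _ (nbhs (0 : R))).
  apply/gtr0_cvgV0; last exact: cvgr_idn.
  near=> n; rewrite ltr0n; near: n; exact: nbhs_infty_gt.
exact: (@sqrt_continuous R 0).
Unshelve. all: by end_near. Qed.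

Theorem theorem1p2 (d : measure_display) (T : measurableType d) (R : realType)
  (P : probability T R) (y : forall n : nat, 'I_n -> 'I_n -> {RV P >-> R})
  (p q : nat -> nat) :
  (forall n, iid_std_normal_matrix (y n)) ->
  (forall n, (0 < n)%N -> (1 <= p n <= n)%N /\ (1 <= q n <= n)%N) ->
  (((fun n => ((p n * q n ^ 2)%:R / n%:R : R)) @ \oo --> (0 : R)) ->
     forall eps : R, 0 < eps ->
       (fun n => P [set t | (eps <= HS_dist (p n) (q n) (Ymat (y n) t))%R])
         @ \oo --> 0%E)
  /\
  (forall sigma : R, 0 < sigma ->
     ((fun n => ((p n * q n ^ 2)%:R / n%:R : R)) @ \oo --> sigma) ->
     forall eps : R, 0 < eps -> eps < Num.sqrt (sigma / 2) ->
       (0 < limn_einf (fun n =>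
              P [set t | (eps <= HS_dist (p n) (q n) (Ymat (y n) t))%R]))%E).
Proof.
move=> iidy pqn; set r := fun n => _.
pose pr eps n : R := fine (P [set t | (eps <= HS_dist (p n) (q n) (Ymat (y n) t))%R]).
have far n eps : 0 < eps -> exists nu : probability (mxT R n) R, [/\ std_normal_mx nu,
    pr eps n = fine (nu (far_event (p n) (q n) eps)) &
    P [set t | (eps <= HS_dist (p n) (q n) (Ymat (y n) t))%R] = (pr eps n)%:E].
  move=> e0; have [nu nuN nuE] := std_normal_Ymat (iidy n).
  have e : P [set t | (eps <= HS_dist (p n) (q n) (Ymat (y n) t))%R] =
      nu (far_event (p n) (q n) eps) by rewrite nuE far_eventE.
  exists nu; split; [exact: nuN|by rewrite /pr e|].
  by rewrite /pr e fineK//; apply: fin_num_measure; exact: measurable_far_event nuN _ _ _.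
(* Since [1 <= p], a bound on [p q^2 / n] also bounds [q^2 / n]; this is the range in which the
   column estimates hold. *)
have qB (B : R) n : (1 < n)%N -> r n <= B ->
    [/\ (p n <= n)%N, (q n <= n)%N & (q n)%:R ^+ 2 <= B * n%:R].
  move=> n1 rB; have n0 := ltnW n1; have [/andP[p1 pn] /andP[q1 qn]] := pqn n n0.
  split=> //; move: rB; rewrite ler_pdivrMr ?ltr0n//; apply: le_trans.
  by rewrite natrM natrX ler_peMl ?sqr_ge0// ler1n.
split=> [r0 eps e0|sigma s0 rs eps e0 es].
  apply: (@squeeze_cvge _ _ _ _ (cst 0%E) _ (fun n => (11 * 1 / eps ^+ 2 * r n)%:E)).
  - near=> n; have [nu [nuN e ->]] := far n eps e0.
    rewrite !lee_fin /= e fine_ge0//=.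
    have n1 : (1 < n)%N by near: n; exact: nbhs_infty_gt.
    have rn : r n <= 1.
      by near: n; apply: (cvgr_le _ r0); exact: ltr01.
    have [pn qn q2] := qB _ _ n1 rn.
    exact: (far_event_le nuN pn qn (lexx 1) q2 n1 e0).
  - exact: cvg_cst.
  - apply: cvg_EFin; first by near=> n.
    by rewrite -(mulr0 (11 * 1 / eps ^+ 2)); apply: cvgM => //; exact: cvg_cst.
pose B := sigma + 1.
have B1 : 1 <= B by rewrite lerDr ltW.
(* The gap between the limit of the means and the threshold [eps^2]. *)
pose eta := sigma / 2 - eps ^+ 2.
have eta0 : 0 < eta.
  rewrite subr_gt0 -[X in _ < X]sqr_sqrtr ?divr_ge0 ?ltW//.
  by rewrite ltr_pXn2r ?nnegrE ?sqrtr_ge0 ?ltW.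
(* [C] bounds the second moment of the block error once [r n <= B]; [L] is then large enough for
   [C / (2 L) <= eta / 2], and the added 1 keeps it positive. *)
pose C := err4_bound B * B + 2 * (2 * defect4_bound B + 6) * B ^+ 2.
have k0 : 0 <= 2 * (2 * defect4_bound B + 6).
  by have := defect4_bound_ge0 B; lra.
have C0 : 0 <= C.
  apply: addr_ge0; apply: mulr_ge0;
    [exact: err4_bound_ge0|exact: le_trans B1|exact: k0|exact: sqr_ge0].
pose L := (C + 1) / eta.
have L0 : 0 < L by rewrite divr_gt0// ltr_wpDl.
(* Out of [eta], the convergence of the means loses [eta / 4] and the second moment [eta / 2]; the
   remaining [eta / 4] is at most [L / 2] times the probability. *)
apply: (@limn_einf_gt0 _ _ (eta / (2 * L))); first by rewrite divr_gt0// mulr_gt0.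
have lim : (fun n => r n * (2^-1 - (24 * B + 2 * defect4_bound B) / Num.sqrt n%:R))
    @ \oo --> sigma / 2.
  rewrite -[X in _ --> X]/(sigma * 2^-1) -[2^-1 in X in _ --> X]subr0.
  apply: cvgM => //; apply: cvgB; first exact: cvg_cst.
  rewrite -(mulr0 (24 * B + 2 * defect4_bound B)); apply: cvgM; first exact: cvg_cst.
  exact: cvg_sqrt_natV.
near=> n; have [nu [nuN e ->]] := far n eps e0.
have n1 : (1 < n)%N by near: n; exact: nbhs_infty_gt.
have rn : r n <= B.
  by near: n; apply: (cvgr_le _ rs); rewrite ltrDl.
have rn0 : 0 <= r n by rewrite divr_ge0.
have [pn qn q2] := qB _ _ n1 rn.
have := far_event_ge nuN pn qn B1 q2 n1 eps L0; rewrite -e -/(r n).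
have h : sigma / 2 - eta / 4 <=
    r n * (2^-1 - (24 * B + 2 * defect4_bound B) / Num.sqrt n%:R).
  by near: n; apply: (cvgr_ge _ lim); rewrite ltrBlDr ltrDl divr_gt0.
have h2 : (err4_bound B * r n + 2 * (2 * defect4_bound B + 6) * r n ^+ 2) / (2 * L)
    <= eta / 2.
  apply: (@le_trans _ _ (C / (2 * L))).
    apply: ler_wpM2r; first by rewrite invr_ge0 mulr_ge0// ltW.
    apply: lerD; apply: ler_wpM2l => //; [exact: err4_bound_ge0|exact: ler_sqr].
  rewrite ler_pdivrMr; last by rewrite mulr_gt0.
  rewrite /L.
  have -> : eta / 2 * (2 * ((C + 1) / eta)) = C + 1 by field; rewrite gt_eqF.
  by rewrite lerDl.
move=> /(le_trans h) h3; rewrite lee_fin ler_pdivrMr; last exact: mulr_gt0.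
have e4 : eta = sigma / 2 - eps ^+ 2 by [].
move: h2 h3; set X := _ / (2 * L) => h2 h3.
have : sigma / 2 - eta / 4 <= eps ^+ 2 + eta / 2 + L / 2 * pr eps n by lra.
lra.
Unshelve. all: by end_near. Qed.
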